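(* Let $\gamma_L,\gamma_R,\alpha_L,\alpha_R,b\in\mathbb{R}$ and consider the planar piecewise linear system $$\begin{cases}\dot x=2\gamma_L x-y-b,\\ \dot y=(1+\gamma_L^2)x-\alpha_L,\end{cases}\ \text{if } x\le 0,\qquad \begin{cases}\dot x=2\gamma_R x-y+b,\\ \dot y=(1+\gamma_R^2)x-\alpha_R,\end{cases}\ \text{if } x>0.$$ Put $x_\Lambda=\alpha_\Lambda/(1+\gamma_\Lambda^2)$ for $\Lambda\in\{L,R\}$, $y_L=2\gamma_Lx_L-b$ and $y_R=2\gamma_Rx_R+b$. The periodic orbit at infinity is hyperbolic and stable (unstable) whenever $\gamma_L+\gamma_R>0$ ($\gamma_L+\gamma_R<0$). In the case $\gamma_L+\gamma_R=0$ the periodic orbit at infinity is non-hyperbolic, so that it behaves like a weak-focus or a center. In such a case, the following statements hold. (a) If $\gamma_L=-\gamma_R$ and $y_L-y_R\neq0$ (equivalently, $b-\gamma_L(x_L+x_R)\ne0$), then the periodic orbit at infinity behaves like a weak-focus of order $1$. It is stable when $y_R-y_L>0$ (equivalently, $b>\gamma_L(x_L+x_R)$) and unstable otherwise. (b) If $\gamma_L=-\gamma_R\neq0$ and the two conditions $y_L=y_R$ and $x_L^2-x_R^2\ne0$ hold, then the periodic orbit at infinity behaves like a weak-focus of order $2$, and it is stable (unstable) when $\gamma_L(x_L^2-x_R^2)>0$ ($\gamma_L(x_L^2-x_R^2)<0$). (c) If $\gamma_L=-\gamma_R\neq0$ and the two conditions $y_L=y_R=0$ and $x_L=x_R\ne0$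 hold, then the periodic orbit at infinity behaves like a weak-focus of order $3$, and it is stable (unstable) when $\gamma_Lx_L<0$ ($\gamma_Lx_L>0$). (d) Otherwise, that is, when the three conditions $\gamma_L=-\gamma_R$, $y_L=y_R$ and $x_L=-x_R$ hold, so that $b=0$ also holds, there is a center (period annulus) at infinity and we are in one of the following three cases: $\gamma_L=\gamma_R=0$ and $b=0$; or $\gamma_L=-\gamma_R\neq0$, $x_L=x_R=0$ and $b=0$; or $\gamma_L=-\gamma_R\ne0$, $x_L=-x_R\ne0$ and $b=0$. Thus, the periodic orbit at infinity is stable but not isolated, and so it is not orbitally asymptotically stable.
   Context: On $\Sigma=\{x=0\}$ the system is understood with the Filippov convention; orbits far from the origin cross $\Sigma$. The points $(x_L,y_L)$, $(x_R,y_R)$ are the equilibria of the left and right linear systems, with eigenvalues $\gamma_L\pm i$, $\gamma_R\pm i$. Half-return maps. For $y_0>0$ large, the orbit of the left system starting at $(0,y_0)$ reaches, forward in time through $x\le0$, a point $(0,y_1)$ with $y_1<0$; the orbit of the right system through $(0,y_0)$ reaches, backward in time through $x\ge0$, a point $(0,y_2)$ with $y_2<0$ (these arrival ordinates $y_1,y_2$ are not to be confused with $y_L,y_R$). For $u_0=1/y_0>0$ small put $L(u_0)=1/y_1$, $R(u_0)=1/y_2$ and define the displacement map $\Delta(u_0)=L(u_0)-R(u_0)$. These maps extend analytically to $u_0=0$ with value $0$ there, and $\Delta(u_0)=\Delta_1u_0+\Delta_2u_0^2+\Delta_3u_0^3+\cdots$. The value $u_0=0$ represents the periodic orbit at infinity.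 The periodic orbit at infinity is hyperbolic if $\Delta_1\ne0$ (equivalently, the derivative $L'(0)/R'(0)$ at $0$ of the return map $L\circ R^{-1}$ is not $1$). In the hyperbolic and weak-focus cases it is stable (unstable) if $y_1-y_2<0$ ($y_1-y_2>0$) for all small $u_0>0$, i.e. nearby orbits approach (move away from) infinity. It behaves like a weak-focus of order $i-1$ if $\Delta_1=0$ and $\Delta_i$ is the first non-vanishing coefficient; it behaves like a center if $\Delta\equiv0$ near $0$ (all orbits near infinity are periodic).
   Formalization: In (d), ''otherwise'' is not equivalent to the three conditions (fails for γ_L=γ_R=b=0, x_L=1, x_R=0). It is replaced by: the three conditions hold, or γ_L=γ_R=b=0 with x_L, x_R arbitrary; all conclusions of (d) are stated in this full case. *)

(* Defs.v *)
From Stdlib Require Import Reals.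
From Coquelicot Require Import Coquelicot.
Open Scope R_scope.

Definition left_field (gL aL b : R) (p : R * R) : R * R :=
  (2 * gL * fst p - snd p - b, (1 + gL ^ 2) * fst p - aL).

Definition right_field (gR aR b : R) (p : R * R) : R * R :=
  (2 * gR * fst p - snd p + b, (1 + gR ^ 2) * fst p - aR).

Definition solves (f : R * R -> R * R) (z : R -> R * R) : Prop :=
  forall t : R,
    is_derive (fun s => fst (z s)) t (fst (f (z t))) /\
    is_derive (fun s => snd (z s)) t (snd (f (z t))).

Definition left_return (f : R * R -> R * R) (y0 y1 : R) : Prop :=
  y1 < 0 /\
  exists (z : R -> R * R) (T : R),
    solves f z /\ 0 < T /\ z 0 = (0, y0) /\ z T = (0, y1) /\
    (forall t : R, 0 <= t <= T -> fst (z t) <= 0).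

(* Followed backward in time, hence the arrival time [- T]. *)
Definition right_return (f : R * R -> R * R) (y0 y2 : R) : Prop :=
  y2 < 0 /\
  exists (z : R -> R * R) (T : R),
    solves f z /\ 0 < T /\ z 0 = (0, y0) /\ z (- T) = (0, y2) /\
    (forall t : R, - T <= t <= 0 -> 0 <= fst (z t)).

Definition returns_well_defined (fL fR : R * R -> R * R) : Prop :=
  exists Y : R, 0 < Y /\
    forall y0 : R, Y < y0 ->
      (exists! y1 : R, left_return fL y0 y1) /\
      (exists! y2 : R, right_return fR y0 y2).

(* [iota P] is the unique point satisfying [P]; these two ordinates are
   meaningful only for large [y0], see [returns_well_defined]. *)
Definition ord1 (fL : R * R -> R * R) (y0 : R) : R :=
  iota (fun y1 : R => left_return fL y0 y1).

Definition ord2 (fR : R * R -> R * R) (y0 : R) : R :=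
  iota (fun y2 : R => right_return fR y0 y2).

Definition Lmap (fL : R * R -> R * R) (u : R) : R := / ord1 fL (/ u).

Definition Rmap (fR : R * R -> R * R) (u : R) : R := / ord2 fR (/ u).

Definition Delta (fL fR : R * R -> R * R) (u : R) : R :=
  Lmap fL u - Rmap fR u.

(* [c] is the sequence of Taylor coefficients at 0 of the analytic extension
   of [Delta].  The half-return maps only make sense for [u > 0], and a power
   series is determined by its sum on a right neighbourhood of 0. *)
Definition displacement_series (fL fR : R * R -> R * R) (c : nat -> R) : Prop :=
  c 0%nat = 0 /\
  exists eps : R, 0 < eps /\
    forall u : R, 0 < u < eps -> is_pseries c u (Delta fL fR u).

Definition hyperbolic_at_infinity (fL fR : R * R -> R * R) : Prop :=
  exists c : nat -> R, displacement_series fL fR c /\ c 1%nat <> 0.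

(* Order [k] means that the first non-vanishing coefficient has index [k + 1]. *)
Definition weak_focus_at_infinity (fL fR : R * R -> R * R) (k : nat) : Prop :=
  (1 <= k)%nat /\
  exists c : nat -> R,
    displacement_series fL fR c /\
    (forall i : nat, (i <= k)%nat -> c i = 0) /\ c (S k) <> 0.

Definition center_at_infinity (fL fR : R * R -> R * R) : Prop :=
  exists eps : R, 0 < eps /\ forall u : R, 0 < u < eps -> Delta fL fR u = 0.

Definition stable_at_infinity (fL fR : R * R -> R * R) : Prop :=
  exists eps : R, 0 < eps /\
    forall u : R, 0 < u < eps -> ord1 fL (/ u) - ord2 fR (/ u) < 0.

Definition unstable_at_infinity (fL fR : R * R -> R * R) : Prop :=
  exists eps : R, 0 < eps /\
    forall u : R, 0 < u < eps -> ord1 fL (/ u) - ord2 fR (/ u) > 0.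

(* The Filippov differential inclusion: on the line [x = 0] the admissible
   velocities are the convex combinations of the two fields. *)
Definition filippov (fL fR : R * R -> R * R) (p v : R * R) : Prop :=
  (fst p < 0 -> v = fL p) /\
  (0 < fst p -> v = fR p) /\
  (fst p = 0 ->
     exists l : R, 0 <= l <= 1 /\
       fst v = l * fst (fL p) + (1 - l) * fst (fR p) /\
       snd v = l * snd (fL p) + (1 - l) * snd (fR p)).

(* Trajectories are primitives of Riemann integrable selections of the
   inclusion; this contains all concatenations of arcs of the two linear
   systems and of sliding arcs.  Both fields are affine, so that every
   trajectory is defined for all times. *)
Definition trajectory (fL fR : R * R -> R * R) (z : R -> R * R) : Prop :=
  exists v : R -> R * R, forall t : R,
    filippov fL fR (z t) (v t) /\
    is_RInt (fun s => fst (v s)) 0 t (fst (z t) - fst (z 0)) /\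
    is_RInt (fun s => snd (v s)) 0 t (snd (z t) - snd (z 0)).

Definition radius (p : R * R) : R := sqrt (fst p ^ 2 + snd p ^ 2).

Definition periodic (z : R -> R * R) : Prop :=
  (exists T : R, 0 < T /\ forall t : R, z (t + T) = z t) /\
  (exists t : R, z t <> z 0).

Definition period_annulus_at_infinity (fL fR : R * R -> R * R) : Prop :=
  exists rho : R, forall p : R * R, rho < radius p ->
    (exists z : R -> R * R, trajectory fL fR z /\ z 0 = p) /\
    (forall z : R -> R * R, trajectory fL fR z -> z 0 = p -> periodic z).

(* The sets [rho < radius p] are the neighbourhoods of the orbit at infinity. *)
Definition orbitally_stable_at_infinity (fL fR : R * R -> R * R) : Prop :=
  forall rho : R, exists rho' : R,
    forall z : R -> R * R, trajectory fL fR z -> rho' < radius (z 0) ->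
      forall t : R, 0 <= t -> rho < radius (z t).

Definition orbitally_asymptotically_stable_at_infinity
    (fL fR : R * R -> R * R) : Prop :=
  orbitally_stable_at_infinity fL fR /\
  exists rho : R,
    forall z : R -> R * R, trajectory fL fR z -> rho < radius (z 0) ->
      is_lim (fun t => radius (z t)) p_infty p_infty.

Definition isolated_at_infinity (fL fR : R * R -> R * R) : Prop :=
  exists rho : R,
    ~ exists z : R -> R * R,
        trajectory fL fR z /\ periodic z /\ forall t : R, rho < radius (z t).

(* Main.v *)
Require Import Defs.
From Stdlib Require Import Reals Lra Lia Arith ZArith Classical FunctionalExtensionality.
From Coquelicot Require Import Coquelicot.
Open Scope R_scope.

(** In the coordinate [u = 1/y] of the section, the half-return map [L] of a
linear system with equilibrium abscissa [a] satisfies the singular equation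
[u V(u) (1 + b L) L' = (1 + b u) V(L) L] with [V(u) = (1 + k u)^2 + (a u)^2]
and [k = b - g a].  Writing [L = u m], the coefficients of [m] are determined
recursively by [m(0) = - exp (- g pi)], and a majorant argument on partial sums
gives convergence.  Conversely the equation says that
[ln (radius of the end point / radius of the initial point) - g * (swept angle)]
is constant along the solution, and it tends to 0 as [u -> 0]; hence the orbit of
[(0, 1/u)] does reach [(0, 1/L(u))], and the sum of the series is the half-return
map.  The right system is the left one for [(-g, -a, -b)] after
[(x, t) -> (-x, -t)], hence the displacement series is a difference of two such
series, and its first coefficients decide (a), (b) and (c).

In case (d) one has [b = 0], so that the horizontal velocity is continuous across
[x = 0]: far from the origin every Filippov trajectory crosses the section
transversally, and is forced to follow alternately the left and right half-orbits,
which close up. *)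

(** * Power series solutions of the half-return equation *)

(** The equation comes from the divergence formula dy1/dy0 = exp(2 g T) (y0 + b) / (y1 + b), where
    exp(2 g T) is the squared ratio of the distances to the equilibrium in rotating coordinates,
    namely sqrt(V(u)) / u at the start and sqrt(V(L)) / |L| at the end. The return time T thus drops
    out, and no implicit equation has to be solved at infinity. The singularity at u = 0 is only
    apparent: (1 + b u) V(u m) - (1 + b u m) V(u) is divisible by u (m - 1), and the equation for m
    becomes V(u) (1 + b u m) m' = m (m - 1) K, where m' has coefficient 1 at u = 0. Hence every
    value m(0) is admissible. The elimination of T has lost the swept angle, and the choice m(0) = -
    exp (- g pi) restores it: seen from infinity, an orbit makes exactly half a turn. Moving the
    part of V(u) (1 + b u m) m' beyond m' to the right makes the recursion explicit. The derivative
    in that term costs a factor at most n + 1, which is the factor that the left side divides by, so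
    weighted l1 norms of truncations close up. *)

Definition agree (n : nat) (a b : nat -> R) : Prop :=
  forall k : nat, (k <= n)%nat -> a k = b k.

Definition causal (F : (nat -> R) -> nat -> R) : Prop :=
  forall (a b : nat -> R) (n : nat), agree n a b -> F a n = F b n.

(** A new term may depend on all earlier ones, so the recursion builds whole sequences [P n], final
    up to index [n], and takes their diagonal; causality makes the later entries harmless. *)
Lemma causal_recursion (F : (nat -> R) -> nat -> R) (m0 : R) :
  causal F ->
  exists m : nat -> R, m 0%nat = m0 /\ forall n : nat, m (S n) = F m n.
Proof.
  intros HF.
  set (P := fix P (n : nat) : nat -> R :=
    match n with
    | O => fun _ => m0
    | S k => fun i => if le_lt_dec i k then P k i else F (P k) k
    end).
  assert (HP : forall n k, (k <= n)%nat -> P n k = P k k).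
  { induction n as [|n IH]; intros k Hk.
    - now replace k with 0%nat by lia.
    - destruct (Nat.eq_dec k (S n)) as [->|h]; [easy|].
      simpl. destruct (le_lt_dec k n); [apply IH|]; lia. }
  exists (fun n => P n n). split; [easy|].
  intros n.
  change (P (S n) (S n)) with
    (if le_lt_dec (S n) n then P n (S n) else F (P n) n).
  destruct (le_lt_dec (S n) n) as [h|h]; [lia|].
  apply HF. intros k Hk. now apply HP.
Qed.

Lemma PS_mult_agree (a a' b b' : nat -> R) (n : nat) :
  agree n a a' -> agree n b b' -> PS_mult a b n = PS_mult a' b' n.
Proof.
  intros Ha Hb. unfold PS_mult. apply sum_eq. intros i Hi.
  rewrite Ha by lia. rewrite Hb by lia. easy.
Qed.

(** The l1 norm with weights [rho ^ n] of the truncation at degree [N]. Truncation keeps every bound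
    finite before convergence is known, so that bounds can be proved by induction on [N]. *)
Definition weight (rho : R) (a : nat -> R) (N : nat) : R :=
  sum_f_R0 (fun n => Rabs (a n) * rho ^ n) N.

Lemma weight_S (rho : R) (a : nat -> R) (N : nat) :
  weight rho a (S N) = weight rho a N + Rabs (a (S N)) * rho ^ S N.
Proof. reflexivity. Qed.

Lemma weight_ge_0 (rho : R) (a : nat -> R) (N : nat) :
  0 <= rho -> 0 <= weight rho a N.
Proof.
  intros Hr. apply cond_pos_sum. intros n.
  apply Rmult_le_pos; [apply Rabs_pos | now apply pow_le].
Qed.

Lemma weight_le (rho : R) (a : nat -> R) (N M : nat) :
  0 <= rho -> (N <= M)%nat -> weight rho a N <= weight rho a M.
Proof.
  intros Hr H. induction H as [|M H IH]; [lra|].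
  rewrite weight_S.
  assert (0 <= Rabs (a (S M)) * rho ^ S M); [|lra].
  apply Rmult_le_pos; [apply Rabs_pos | now apply pow_le].
Qed.

Lemma weight_dominated (rho : R) (a b : nat -> R) (N : nat) :
  0 <= rho -> (forall n, Rabs (a n) <= Rabs (b n)) ->
  weight rho a N <= weight rho b N.
Proof.
  intros Hr H. apply sum_Rle. intros n _.
  apply Rmult_le_compat_r; [now apply pow_le | apply H].
Qed.

Lemma weight_plus (rho : R) (a b : nat -> R) (N : nat) :
  0 <= rho ->
  weight rho (fun n => a n + b n) N <= weight rho a N + weight rho b N.
Proof.
  intros Hr. unfold weight. rewrite <- plus_sum. apply sum_Rle. intros n _.
  rewrite <- Rmult_plus_distr_r.
  apply Rmult_le_compat_r; [now apply pow_le | apply Rabs_triang].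
Qed.

Lemma weight_scal (rho c : R) (a : nat -> R) (N : nat) :
  weight rho (fun n => c * a n) N = Rabs c * weight rho a N.
Proof.
  unfold weight. rewrite scal_sum. apply sum_eq. intros n _.
  rewrite Rabs_mult. ring.
Qed.

Definition shift (a : nat -> R) (n : nat) : R :=
  match n with O => 0 | S k => a k end.

Lemma weight_shift (rho : R) (a : nat -> R) (N : nat) :
  0 <= rho -> weight rho (shift a) N <= rho * weight rho a N.
Proof.
  intros Hr. destruct N as [|N].
  - unfold weight; simpl. rewrite Rabs_R0.
    assert (0 <= rho * Rabs (a 0%nat)).
    { apply Rmult_le_pos; [lra|apply Rabs_pos]. } lra.
  - apply Rle_trans with (rho * weight rho a N).
    + clear. induction N as [|N IH].
      * unfold weight; simpl. rewrite Rabs_R0. lra.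
      * rewrite weight_S, (weight_S rho a N). simpl shift. simpl pow in *.
        lra.
    + apply Rmult_le_compat_l; [lra|]. apply weight_le; [lra|lia].
Qed.

Definition cst (c : R) (n : nat) : R := match n with O => c | S _ => 0 end.

Lemma weight_cst (rho c : R) (N : nat) : weight rho (cst c) N = Rabs c.
Proof.
  induction N as [|N IH].
  - unfold weight; simpl. ring.
  - rewrite weight_S, IH. simpl cst. rewrite Rabs_R0. ring.
Qed.

(** Terms of degree at most [N] in the product involve only pairs of indices with sum at most [N];
    the intermediate sum runs over this triangle, which is part of the square of the two
    truncations. *)
Lemma weight_mult (rho : R) (a b : nat -> R) (N : nat) :
  0 <= rho ->
  weight rho (PS_mult a b) N <= weight rho a N * weight rho b N.
Proof.
  intros Hr.
  apply Rle_trans with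
    (sum_f_R0 (fun k => Rabs (a k) * rho ^ k * weight rho b (N - k)) N).
  - induction N as [|N IH].
    + unfold weight, PS_mult; simpl. rewrite Rabs_mult. lra.
    + rewrite weight_S, tech5, Nat.sub_diag.
      rewrite (sum_eq _ (fun k => Rabs (a k) * rho ^ k * weight rho b (N - k)
         + Rabs (a k) * Rabs (b (S N - k)%nat) * rho ^ S N)).
      2:{ intros k Hk. replace (S N - k)%nat with (S (N - k)) by lia.
          rewrite weight_S.
          replace (rho ^ S N) with (rho ^ k * rho ^ S (N - k)).
          - ring.
          - rewrite <- pow_add. f_equal. lia. }
      rewrite plus_sum.
      assert (Rabs (PS_mult a b (S N)) * rho ^ S N <=
        sum_f_R0 (fun k => Rabs (a k) * Rabs (b (S N - k)%nat) * rho ^ S N) N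
        + Rabs (a (S N)) * (rho ^ S N) * weight rho b 0).
      { rewrite <- (scal_sum (fun k => Rabs (a k) * Rabs (b (S N - k)%nat))).

        replace (weight rho b 0) with (Rabs (b 0%nat))
          by (unfold weight; simpl; ring).
        replace (rho ^ S N * sum_f_R0 (fun k => Rabs (a k) * Rabs (b (S N - k)%nat)) N
          + Rabs (a (S N)) * rho ^ S N * Rabs (b 0%nat)) with
          ((sum_f_R0 (fun k => Rabs (a k) * Rabs (b (S N - k)%nat)) (S N)) * rho ^ S N).
        2:{ rewrite tech5, Nat.sub_diag. ring. }
        apply Rmult_le_compat_r; [now apply pow_le|].
        unfold PS_mult. eapply Rle_trans; [apply Rsum_abs|].
        apply sum_Rle. intros k _. rewrite Rabs_mult. lra. }
      replace (weight rho b 0) with (weight rho b (S N - S N)) in *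
        by now rewrite Nat.sub_diag.
      rewrite Nat.sub_diag in *. lra.
  - unfold weight at 2.
    rewrite (Rmult_comm (sum_f_R0 _ N)), scal_sum. apply sum_Rle.
    intros k Hk. apply Rmult_le_compat_l.
    + apply Rmult_le_pos; [apply Rabs_pos | now apply pow_le].
    + apply weight_le; [easy|lia].
Qed.

(** * Power series and their sums on a disc *)

Definition sums_to (rho : R) (a : nat -> R) (f : R -> R) : Prop :=
  forall u : R, Rabs u < rho -> is_pseries a u (f u).

(** Multiplying series requires points strictly inside the disc of convergence. Convergence at a
    point [v] strictly between [Rabs u] and [rho] provides this, since its terms tend to 0. *)
Lemma sums_to_radius (rho : R) (a : nat -> R) (f : R -> R) (u : R) :
  sums_to rho a f -> Rabs u < rho -> Rbar_lt (Rabs u) (CV_radius a).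
Proof.
  intros Ha Hu.
  set (v := (Rabs u + rho) / 2).
  assert (Hv : Rabs u < v < rho) by (unfold v; lra).
  apply Rbar_lt_le_trans with (Rabs v).
  - simpl. rewrite (Rabs_pos_eq v); [lra|]. pose proof (Rabs_pos u). lra.
  - destruct (Rbar_le_lt_dec (Rabs v) (CV_radius a)) as [h|h]; [easy|].
    exfalso. apply (CV_disk_outside _ _ h).
    assert (Hs : is_series (fun k => scal (pow_n v k) (a k)) (f v)).
    { apply Ha. rewrite Rabs_pos_eq; [lra|]. pose proof (Rabs_pos u). lra. }
    apply ex_series_lim_0.
    exists (f v). eapply is_series_ext; [|exact Hs].
    intros n. unfold scal; simpl; unfold mult; simpl.
    rewrite pow_n_pow. ring.
Qed.

Lemma sums_to_mult (rho : R) (a b : nat -> R) (f g : R -> R) :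
  sums_to rho a f -> sums_to rho b g ->
  sums_to rho (PS_mult a b) (fun u => f u * g u).
Proof.
  intros Ha Hb u Hu. apply is_pseries_mult.
  - now apply Ha.
  - now apply Hb.
  - now apply (sums_to_radius rho a f).
  - now apply (sums_to_radius rho b g).
Qed.

Lemma sums_to_plus (rho : R) (a b : nat -> R) (f g : R -> R) :
  sums_to rho a f -> sums_to rho b g ->
  sums_to rho (fun n => a n + b n) (fun u => f u + g u).
Proof.
  intros Ha Hb u Hu.
  exact (is_pseries_plus a b u (f u) (g u) (Ha u Hu) (Hb u Hu)).
Qed.

Lemma sums_to_scal (rho c : R) (a : nat -> R) (f : R -> R) :
  sums_to rho a f -> sums_to rho (fun n => c * a n) (fun u => c * f u).
Proof.
  intros Ha u Hu.
  refine (is_pseries_scal c a u (f u) _ (Ha u Hu)).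
  apply Rmult_comm.
Qed.

Lemma sums_to_shift (rho : R) (a : nat -> R) (f : R -> R) :
  sums_to rho a f -> sums_to rho (shift a) (fun u => u * f u).
Proof.
  intros Ha u Hu.
  apply is_pseries_ext with (PS_incr_1 a).
  - now intros [|n].
  - exact (is_pseries_incr_1 a u (f u) (Ha u Hu)).
Qed.

Lemma sums_to_cst (rho c : R) : sums_to rho (cst c) (fun _ => c).
Proof.
  intros u _. apply filterlim_ext with (fun _ => c); [|apply filterlim_const].
  intros n. induction n as [|n IH].
  - rewrite sum_O. change (c = 1 * c). ring.
  - rewrite sum_Sn, <- IH. change (c = c + pow_n u (S n) * 0). ring.
Qed.

Lemma sums_to_ext (rho : R) (a b : nat -> R) (f g : R -> R) :
  (forall n, a n = b n) -> (forall u, f u = g u) ->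
  sums_to rho a f -> sums_to rho b g.
Proof.
  intros Hab Hfg Ha u Hu. rewrite <- Hfg.
  apply is_pseries_ext with a; [easy|now apply Ha].
Qed.

Lemma weight_bounded_sums (rho s : R) (a : nat -> R) :
  0 < rho -> (forall N, weight rho a N <= s) -> sums_to rho a (PSeries a).
Proof.
  intros Hr Hs u Hu. apply PSeries_correct.
  apply CV_radius_inside.
  apply Rbar_lt_le_trans with rho; [easy|].
  apply CV_radius_bounded. exists s. intros n.
  rewrite Rabs_mult, (Rabs_pos_eq (rho ^ n)) by (apply pow_le; lra).
  eapply Rle_trans; [|apply (Hs n)].
  destruct n as [|n]; [unfold weight; simpl; lra|].
  rewrite weight_S. pose proof (weight_ge_0 rho a n ltac:(lra)). lra.
Qed.

Section HalfReturnEquation.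

Variables (p q b : R).

(* The equation for [m], divided by [u], is [m' = m (m - 1) K - (u m') G] with
   [V(u) = 1 + p u + q u^2], [K = p - b + q u (m + 1) + b q u^2 m] and
   [G = (V(u) (1 + b u m) - 1) / u]. *)
Definition eq_K (m : nat -> R) : nat -> R := fun n =>
  cst (p - b) n + (shift (fun i => q * (m i + cst 1 i)) n
    + shift (shift (fun i => b * q * m i)) n).

Definition eq_G (m : nat -> R) : nat -> R := fun n =>
  cst p n + (shift (cst q) n
    + (b * m n + (shift (fun i => b * p * m i) n
                  + shift (shift (fun i => b * q * m i)) n))).

(** The sequence [INR i * m i] is that of u m'. Because of the factor u, the entry of index [n] uses
    only [m 0], ..., [m n]. *)
Definition eq_rhs (m : nat -> R) : nat -> R := fun n =>
  PS_mult m (PS_mult (fun i => m i + cst (-1) i) (eq_K m)) n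
  + (-1) * PS_mult (fun i => INR i * m i) (eq_G m) n.

Lemma eq_K_agree (a c : nat -> R) (n : nat) :
  agree n a c -> agree n (eq_K a) (eq_K c).
Proof.
  intros H k Hk. unfold eq_K, shift.
  destruct k as [|[|k]]; try easy; repeat rewrite H by lia; easy.
Qed.

Lemma eq_G_agree (a c : nat -> R) (n : nat) :
  agree n a c -> agree n (eq_G a) (eq_G c).
Proof.
  intros H k Hk. unfold eq_G, shift.
  destruct k as [|[|k]]; repeat rewrite H by lia; easy.
Qed.

Lemma eq_rhs_causal : causal (fun m n => eq_rhs m n / INR (S n)).
Proof.
  intros a c n H. unfold eq_rhs. f_equal. f_equal; [|f_equal].
  - apply PS_mult_agree; [easy|]. intros k Hk. apply PS_mult_agree.
    + intros i Hi. rewrite H by lia. easy.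
    + intros i Hi. apply (eq_K_agree a c n H). lia.
  - apply PS_mult_agree.
    + intros i Hi. rewrite H by lia. easy.
    + now apply eq_G_agree.
Qed.

Lemma weight_K (rho s : R) (m : nat -> R) (N : nat) :
  0 <= rho <= 1 -> weight rho m N <= s ->
  weight rho (eq_K m) N
    <= Rabs (p - b) + (Rabs q * (s + 1) + Rabs (b * q) * s).
Proof.
  intros Hr Hs.
  pose proof (Rabs_pos q). pose proof (Rabs_pos (b * q)).
  pose proof (weight_ge_0 rho m N ltac:(lra)).
  unfold eq_K.
  eapply Rle_trans; [apply weight_plus; lra|].
  apply Rplus_le_compat; [rewrite weight_cst; lra|].
  eapply Rle_trans; [apply weight_plus; lra|].
  apply Rplus_le_compat.
  - eapply Rle_trans; [apply weight_shift; lra|].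
    rewrite weight_scal.
    pose proof (weight_plus rho m (cst 1) N ltac:(lra)) as H2.
    rewrite weight_cst, Rabs_R1 in H2.
    pose proof (weight_ge_0 rho (fun i => m i + cst 1 i) N ltac:(lra)).
    assert (Rabs q * weight rho (fun i => m i + cst 1 i) N <= Rabs q * (s+1)).
    { apply Rmult_le_compat_l; lra. }
    assert (0 <= Rabs q * weight rho (fun i => m i + cst 1 i) N).
    { now apply Rmult_le_pos. }
    nra.
  - eapply Rle_trans; [apply weight_shift; lra|].
    apply Rle_trans with (1 * (weight rho (shift (fun i => b * q * m i)) N)).
    { apply Rmult_le_compat_r; [apply weight_ge_0; lra|lra]. }
    rewrite Rmult_1_l.
    eapply Rle_trans; [apply weight_shift; lra|].
    rewrite weight_scal.
    assert (Rabs (b*q) * weight rho m N <= Rabs (b*q) * s).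
    { apply Rmult_le_compat_l; lra. }
    assert (0 <= Rabs (b*q) * weight rho m N) by now apply Rmult_le_pos.
    nra.
Qed.

Lemma weight_G (rho s : R) (m : nat -> R) (N : nat) :
  0 <= rho <= 1 -> weight rho m N <= s ->
  weight rho (eq_G m) N
    <= Rabs p + (Rabs q + (Rabs b * s + (Rabs (b * p) * s + Rabs (b * q) * s))).
Proof.
  intros Hr Hs.
  pose proof (Rabs_pos q). pose proof (Rabs_pos b).
  pose proof (Rabs_pos (b * q)). pose proof (Rabs_pos (b * p)).
  pose proof (weight_ge_0 rho m N ltac:(lra)).
  assert (Hsh : forall a S, weight rho a N <= S -> weight rho (shift a) N <= S).
  { intros a S HS. eapply Rle_trans; [apply weight_shift; lra|].
    pose proof (weight_ge_0 rho a N ltac:(lra)). nra. }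
  assert (Hsc : forall c, weight rho (fun i => c * m i) N <= Rabs c * s).
  { intros c. rewrite weight_scal. apply Rmult_le_compat_l; [apply Rabs_pos|lra]. }
  unfold eq_G.
  repeat (eapply Rle_trans; [apply weight_plus; lra|];
          apply Rplus_le_compat);
    repeat apply Hsh; rewrite ?weight_cst; try apply Hsc; lra.
Qed.

(** The derivative multiplies the coefficient of index [k <= n] by [k], and the division by
    [INR (S n)] absorbs this factor. What remains is a product without derivative, within reach of
    [weight_mult]. *)
Lemma eq_rhs_bound (m : nat -> R) (n : nat) :
  Rabs (eq_rhs m n / INR (S n))
    <= PS_mult (fun i => Rabs (m i)) (fun j =>
         Rabs (PS_mult (fun i => m i + cst (-1) i) (eq_K m) j)
         + Rabs (eq_G m j)) n.
Proof.
  assert (Hn : 1 <= INR (S n)).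
  { rewrite S_INR. pose proof (pos_INR n). lra. }
  unfold Rdiv. rewrite Rabs_mult, (Rabs_pos_eq (/ INR (S n))).
  2:{ left. apply Rinv_0_lt_compat. lra. }
  apply Rmult_le_reg_r with (INR (S n)); [lra|].
  rewrite Rmult_assoc, Rinv_l, Rmult_1_r by lra.
  unfold eq_rhs. eapply Rle_trans; [apply Rabs_triang|].
  rewrite (Rabs_mult (-1)), Rabs_m1, Rmult_1_l.
  unfold PS_mult at 1 3 4.
  rewrite Rmult_comm, scal_sum.
  eapply Rle_trans; [apply Rplus_le_compat; apply Rsum_abs|].
  rewrite <- plus_sum. apply sum_Rle. intros k Hk.
  rewrite !Rabs_mult.
  assert (Hk' : Rabs (INR k) <= INR (S n)).
  { rewrite Rabs_pos_eq by apply pos_INR. apply le_INR. lia. }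
  set (A := Rabs (m k)). set (B := Rabs (PS_mult _ _ _)).
  set (C := Rabs (eq_G m _)).
  assert (0 <= A) by apply Rabs_pos. assert (0 <= B) by apply Rabs_pos.
  assert (0 <= C) by apply Rabs_pos.
  assert (0 <= A * B) by now apply Rmult_le_pos.
  assert (0 <= A * C) by now apply Rmult_le_pos.
  nra.
Qed.

(* The partial sums [weight rho m N] satisfy [w (N+1) <= |m 0| + rho * C] as
   long as [w N <= |m 0| + 1], with [C] independent of [N]. *)
Lemma half_return_equation_solution (m0 : R) :
  exists (m : nat -> R) (rho : R),
    m 0%nat = m0 /\ (forall n, INR (S n) * m (S n) = eq_rhs m n) /\
    0 < rho /\ sums_to rho m (PSeries m).
Proof.
  destruct (causal_recursion _ m0 eq_rhs_causal) as [m [Hm0 Hm]].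
  exists m.
  set (s := Rabs m0 + 1).
  set (CK := Rabs (p - b) + (Rabs q * (s + 1) + Rabs (b * q) * s)).
  set (CG := Rabs p + (Rabs q + (Rabs b * s + (Rabs (b * p) * s + Rabs (b * q) * s)))).
  set (C := s * ((s + 1) * CK + CG)).
  assert (Hs : 1 <= s) by (unfold s; pose proof (Rabs_pos m0); lra).
  assert (HCK : 0 <= CK).
  { unfold CK. pose proof (Rabs_pos (p - b)). pose proof (Rabs_pos q).
    pose proof (Rabs_pos (b * q)). nra. }
  assert (HCG : 0 <= CG).
  { unfold CG. pose proof (Rabs_pos p). pose proof (Rabs_pos q).
    pose proof (Rabs_pos (b * q)). pose proof (Rabs_pos (b * p)).
    pose proof (Rabs_pos b). nra. }
  assert (HC : 0 <= C).
  { unfold C. apply Rmult_le_pos; [lra|]. nra. }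
  (* [rho <= 1] is required by [weight_K] and [weight_G], and [rho * C <= 1] keeps the next partial
     sum below [s]. *)
  set (rho := / (1 + C)).
  assert (Hrho : 0 < rho) by (apply Rinv_0_lt_compat; lra).
  assert (HrC : rho * (1 + C) = 1) by (unfold rho; field; lra).
  assert (Hr1 : rho <= 1) by nra.
  assert (Hw : forall N, weight rho m N <= s).
  { assert (Hsplit : forall N, weight rho m (S N) =
      Rabs m0 + rho * weight rho (fun n => m (S n)) N).
    { induction N as [|N IH].
      - unfold weight; simpl. rewrite Hm0. ring.
      - rewrite weight_S, IH, (weight_S rho (fun n => m (S n))). simpl pow. ring. }
    induction N as [|N IH].
    - unfold weight; simpl. rewrite Hm0. unfold s. lra.
    - rewrite Hsplit.
      set (X := fun j =>
         Rabs (PS_mult (fun i => m i + cst (-1) i) (eq_K m) j)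
         + Rabs (eq_G m j)).
      assert (Ha : forall a, weight rho (fun i => Rabs (a i)) N = weight rho a N).
      { intros a. unfold weight. apply sum_eq. intros i _. now rewrite Rabs_Rabsolu. }
      assert (HX : weight rho X N <= (s + 1) * CK + CG).
      { unfold X. eapply Rle_trans; [apply weight_plus; lra|].
        rewrite !Ha. apply Rplus_le_compat.
        - eapply Rle_trans; [apply weight_mult; lra|].
          apply Rmult_le_compat; try (apply weight_ge_0; lra).
          + eapply Rle_trans; [apply weight_plus; lra|].
            rewrite weight_cst, Rabs_m1. lra.
          + apply weight_K; [lra|easy].
        - apply weight_G; [lra|easy]. }
      assert (HB : weight rho (fun n => m (S n)) N
                   <= weight rho (PS_mult (fun i => Rabs (m i)) X) N).
      { apply weight_dominated; [lra|]. intros n. rewrite Hm.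
        eapply Rle_trans; [apply eq_rhs_bound|]. apply Rle_abs. }
      assert (HB2 : weight rho (PS_mult (fun i => Rabs (m i)) X) N <= C).
      { eapply Rle_trans; [apply weight_mult; lra|]. rewrite Ha.
        apply Rmult_le_compat; try (apply weight_ge_0; lra); easy. }
      assert (rho * weight rho (fun n => m (S n)) N <= rho * C).
      { apply Rmult_le_compat_l; lra. }
      unfold s. nra. }
  exists rho. repeat split; [easy| |easy|now apply weight_bounded_sums with s].
  intros n. rewrite Hm. field. apply not_0_INR. lia.
Qed.

(** The recursion equates the coefficients of the series of m' and of the right side; both converge
    on the disc, so their sums agree. *)
Lemma half_return_equation_sum (m : nat -> R) (rho : R) :
  (forall n, INR (S n) * m (S n) = eq_rhs m n) ->
  sums_to rho m (PSeries m) ->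
  forall u, Rabs u < rho ->
  exists dM, is_derive (PSeries m) u dM /\
    let M := PSeries m u in
    dM = M * ((M - 1) * (p - b + q * u * (M + 1) + b * q * u ^ 2 * M))
         - u * dM * (p + q * u + b * M * (1 + p * u + q * u ^ 2)).
Proof.
  intros Hm Hs u Hu.
  pose (D := PSeries (PS_derive m)).
  exists (D u).
  assert (HD : forall v, Rabs v < rho -> is_derive (PSeries m) v (D v)).
  { intros v Hv. apply is_derive_PSeries. now apply (sums_to_radius rho m (PSeries m)). }
  split; [now apply HD|].
  assert (HsD : sums_to rho (PS_derive m) D).
  { intros v Hv. unfold D. apply PSeries_correct.
    eexists. apply is_pseries_derive. now apply (sums_to_radius rho m (PSeries m)). }
  assert (HK : sums_to rho (eq_K m) (fun v => p - b +
     (v * (q * (PSeries m v + 1)) + v * (v * (b * q * PSeries m v))))).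
  { unfold eq_K. repeat apply sums_to_plus;
    repeat first [apply sums_to_shift | apply sums_to_scal | apply sums_to_plus | apply sums_to_cst | exact Hs]. }
  assert (HG : sums_to rho (eq_G m) (fun v => p + (v * q + (b * PSeries m v
     + (v * (b * p * PSeries m v) + v * (v * (b * q * PSeries m v))))))).
  { unfold eq_G. repeat apply sums_to_plus;
    repeat first [apply sums_to_shift | apply sums_to_scal | apply sums_to_cst | exact Hs]. }
  assert (HE : sums_to rho (eq_rhs m) (fun v =>
     PSeries m v * ((PSeries m v + -1) * (p - b +
     (v * (q * (PSeries m v + 1)) + v * (v * (b * q * PSeries m v)))))
     + (-1) * ((v * D v) * (p + (v * q + (b * PSeries m v
     + (v * (b * p * PSeries m v) + v * (v * (b * q * PSeries m v))))))))).
  { unfold eq_rhs. apply sums_to_plus.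
    - apply sums_to_mult; [easy|]. apply sums_to_mult; [|easy].
      apply sums_to_plus; [easy|apply sums_to_cst].
    - apply sums_to_scal. apply sums_to_mult; [|easy].
      apply sums_to_ext with (shift (PS_derive m)) (fun v => v * D v).
      + intros [|n]; [simpl; ring|reflexivity].
      + easy.
      + now apply sums_to_shift. }
  assert (HH := HE u Hu).
  assert (HH2 : is_pseries (PS_derive m) u (D u)) by now apply HsD.
  apply is_pseries_ext with (b := PS_derive m) in HH.
  2:{ intros n. rewrite <- Hm. reflexivity. }
  apply is_pseries_unique in HH. apply is_pseries_unique in HH2.
  cbv zeta. rewrite HH in HH2. etransitivity; [symmetry; exact HH2|]. simpl. ring.
Qed.

End HalfReturnEquation.

(** * The closing condition of the half-return *)

Lemma const_on_segment (f : R -> R) (s t : R) :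
  s <= t -> (forall v, s < v < t -> is_derive f v 0) ->
  (forall v, s <= v <= t -> continuous f v) -> f t = f s.
Proof.
  intros Hst Hd Hc.
  destruct (MVT_gen f s t (fun _ => 0)) as [c [_ Hf]].
  - rewrite Rmin_left, Rmax_right by easy. exact Hd.
  - rewrite Rmin_left, Rmax_right by easy. intros v Hv.
    apply continuity_pt_filterlim. now apply Hc.
  - lra.
Qed.

Definition quad (k x u : R) : R := (1 + k * u) ^ 2 + (x * u) ^ 2.

Lemma quad_pos (k x u : R) : 0 < 1 + k * u -> 0 < quad k x u.
Proof. intros H. unfold quad. nra. Qed.

(** Here [x] is the abscissa of the equilibrium. In the rotating coordinates (N, X), the section
    point of ordinate 1/v is - (1 + k v, x v) / v. The positivity of [1 + k * v] at both ends makes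
    the two arguments arctangents without jump; the opposite signs of 1/u and 1/L contribute the
    additional [PI]. *)
Lemma half_return_integral (g x b : R) (M : R -> R) (u : R) :
  let k := b - g * x in
  let p := 2 * k in
  let q := k ^ 2 + x ^ 2 in
  0 < u ->
  M 0 = - exp (- g * PI) ->
  (forall v, 0 <= v <= u ->
     M v < 0 /\ 0 < 1 + k * v /\ 0 < 1 + k * (v * M v) /\
     exists dM, is_derive M v dM /\
       dM = M v * ((M v - 1) * (p - b + q * v * (M v + 1) + b * q * v ^ 2 * M v))
         - v * dM * (p + q * v + b * M v * (1 + p * v + q * v ^ 2))) ->
  / 2 * ln (quad k x (u * M u)) - / 2 * ln (quad k x u) - ln (- M u)
  = g * (PI + atan (x * (u * M u) / (1 + k * (u * M u)))
            - atan (x * u / (1 + k * u))).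
Proof.
  intros k p q Hu HM0 H.
  set (F := fun v => / 2 * ln (quad k x (v * M v)) - / 2 * ln (quad k x v)
     - ln (- M v) - g * (atan (x * (v * M v) / (1 + k * (v * M v)))
            - atan (x * v / (1 + k * v)))).
  (* The only place where the value of [M 0] enters: both arctangents vanish, and [- ln (- M 0)] is
     the contribution of half a turn. *)
  assert (HF0 : F 0 = g * PI).
  { unfold F, quad. rewrite HM0, !Rmult_0_l, !Rmult_0_r, !Rplus_0_r.
    rewrite Rdiv_0_l. rewrite atan_0, Ropp_involutive, ln_exp.
    replace ((1 ^ 2 + 0 ^ 2)) with 1 by ring. rewrite ln_1. ring. }
  assert (HF : forall v, 0 <= v <= u -> is_derive F v 0).
  { intros v Hv. destruct (H v Hv) as [Hn [Hk0 [Hk1 [dM [HdM Heq]]]]].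
    assert (HV0 := quad_pos k x v Hk0). assert (HV1 := quad_pos k x (v * M v) Hk1).
    assert (HexM : ex_derive M v) by now exists dM.
    pose proof (is_derive_unique _ _ _ HdM) as HDM.
    unfold quad in HV0, HV1.
    unfold F, quad. auto_derive.
    - repeat split; try easy; try lra.
    - rewrite (Derive_ext (fun x0 => M x0) M v) by easy.
      rewrite HDM. clear HF0 HexM HdM HDM H F HM0.
      set (m := M v) in *.
      (* The derivative of [F] is the defect of the equation, divided by - V(v) V(v M) M. *)
      match goal with |- ?A = 0 => replace A with
        (- (dM - (m * ((m - 1) * (p - b + q * v * (m + 1) + b * q * v ^ 2 * m))
         - v * dM * (p + q * v + b * m * (1 + p * v + q * v ^ 2))))
         / (((1 + k * v) ^ 2 + (x * v) ^ 2)
            * ((1 + k * (v * m)) ^ 2 + (x * (v * m)) ^ 2) * m)) end.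
      + rewrite <- Heq. field. repeat split; lra.
      + unfold p, q, k in *. field. repeat split; lra. }
  assert (HFu : F u = F 0).
  { apply const_on_segment; [lra| |].
    - intros v Hv. apply HF. lra.
    - intros v Hv. apply (ex_derive_continuous F v). exists 0. now apply HF. }
  rewrite HF0 in HFu. unfold F in HFu. lra.
Qed.

Lemma cos_sin_atan_ratio (a c : R) :
  0 < a ->
  cos (atan (c / a)) = a / sqrt (a ^ 2 + c ^ 2) /\
  sin (atan (c / a)) = c / sqrt (a ^ 2 + c ^ 2).
Proof.
  intros Ha.
  assert (Hs : sqrt (1 + (c / a)²) = sqrt (a ^ 2 + c ^ 2) / a).
  { apply sqrt_lem_1.
    - pose proof (Rle_0_sqr (c / a)). lra.
    - apply Rdiv_le_0_compat; [apply sqrt_pos|easy].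
    - replace (sqrt (a ^ 2 + c ^ 2) / a * (sqrt (a ^ 2 + c ^ 2) / a)) with
        (sqrt (a ^ 2 + c ^ 2) * sqrt (a ^ 2 + c ^ 2) / (a * a)) by (field; lra).
      rewrite sqrt_sqrt by nra. unfold Rsqr. field. lra. }
  assert (0 < sqrt (a ^ 2 + c ^ 2)) by (apply sqrt_lt_R0; nra).
  rewrite cos_atan, sin_atan, Hs. split; field; lra.
Qed.

(** This goes back from polar to Cartesian form: the last two equations say that the rotating
    coordinates of [(0, / u)] become those of [(0, / (u * m))] after time [T]. The bounds on [T]
    hold because arctangents stay strictly between - pi/2 and pi/2. *)
Lemma half_return_closing (g x b m u : R) :
  let k := b - g * x in
  let T := PI + atan (x * (u * m) / (1 + k * (u * m)))
            - atan (x * u / (1 + k * u)) in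
  0 < u -> m < 0 -> 0 < 1 + k * u -> 0 < 1 + k * (u * m) ->
  / 2 * ln (quad k x (u * m)) - / 2 * ln (quad k x u) - ln (- m) = g * T ->
  0 < T < 2 * PI /\
  exp (g * T) * (x * cos T + (/ u + k) * sin T) = x /\
  exp (g * T) * ((/ u + k) * cos T - x * sin T) = / (u * m) + k.
Proof.
  intros k T Hu Hm H0 H1 HT.
  assert (HV0 := quad_pos k x u H0). assert (HV1 := quad_pos k x (u * m) H1).
  split.
  { unfold T. pose proof (atan_bound (x * u / (1 + k * u))).
    pose proof (atan_bound (x * (u * m) / (1 + k * (u * m)))). lra. }
  destruct (cos_sin_atan_ratio (1 + k * u) (x * u) H0) as [c0 s0].
  destruct (cos_sin_atan_ratio (1 + k * (u * m)) (x * (u * m)) H1) as [c1 s1].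
  fold (quad k x u) in c0, s0. fold (quad k x (u * m)) in c1, s1.
  set (r0 := sqrt (quad k x u)) in *.
  set (r1 := sqrt (quad k x (u * m))) in *.
  assert (Hr0 : 0 < r0) by now apply sqrt_lt_R0.
  assert (Hr1 : 0 < r1) by now apply sqrt_lt_R0.
  assert (Hr0' : r0 * r0 = quad k x u) by (apply sqrt_sqrt; lra).
  assert (Hr1' : r1 * r1 = quad k x (u * m)) by (apply sqrt_sqrt; lra).
  assert (He : exp (g * T) = r1 / (r0 * - m)).
  { rewrite <- HT. rewrite <- Hr0', <- Hr1', !ln_mult by easy.
    replace (/ 2 * (ln r1 + ln r1) - / 2 * (ln r0 + ln r0) - ln (- m))
      with (ln r1 + - (ln r0 + ln (- m))) by lra.
    rewrite <- ln_mult by lra.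
    assert (0 < r0 * - m) by (apply Rmult_lt_0_compat; lra).
    rewrite exp_plus, exp_Ropp, !exp_ln by easy. reflexivity. }
  set (t0 := atan (x * u / (1 + k * u))) in *.
  set (t1 := atan (x * (u * m) / (1 + k * (u * m)))) in *.
  assert (HcT : cos T = - (cos t1 * cos t0 + sin t1 * sin t0)).
  { rewrite <- cos_minus, <- neg_cos. f_equal. unfold T. ring. }
  assert (HsT : sin T = - (sin t1 * cos t0 - cos t1 * sin t0)).
  { rewrite <- sin_minus, <- neg_sin. f_equal. unfold T. ring. }
  rewrite HcT, HsT, He, c0, s0, c1, s1.
  unfold quad in Hr0', Hr1'.
  split.
  - transitivity (x * ((1 + k * u) ^ 2 + (x * u) ^ 2) / (r0 * r0)).
    + field. lra.
    + rewrite <- Hr0'. field. lra.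
  - transitivity ((/ (u * m) + k) * ((1 + k * u) ^ 2 + (x * u) ^ 2) / (r0 * r0)).
    + field. lra.
    + rewrite <- Hr0'. field. lra.
Qed.

Lemma half_return_series (g x b : R) :
  let k := b - g * x in
  let p := 2 * k in
  let q := k ^ 2 + x ^ 2 in
  exists (m : nat -> R) (delta : R),
    m 0%nat = - exp (- g * PI) /\
    (forall n, INR (S n) * m (S n) = eq_rhs p q b m n) /\
    0 < delta /\
    forall u, 0 < u < delta ->
    exists mu T : R,
      is_pseries m u mu /\ mu < 0 /\ 0 < T < 2 * PI /\
      0 < / u + k /\ / (u * mu) + k < 0 /\
      0 < / u + b /\ / (u * mu) + b < 0 /\
      exp (g * T) * (x * cos T + (/ u + k) * sin T) = x /\
      exp (g * T) * ((/ u + k) * cos T - x * sin T) = / (u * mu) + k.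
Proof.
  intros k p q.
  destruct (half_return_equation_solution p q b (- exp (- g * PI)))
    as [m [rho [Hm0 [Hm [Hrho Hs]]]]].
  set (lam := exp (- g * PI)) in *.
  assert (Hlam : 0 < lam) by apply exp_pos.
  set (M := PSeries m).
  assert (HM0 : M 0 = - lam) by (unfold M; rewrite PSeries_0; exact Hm0).
  assert (Hc : continuous M 0).
  { destruct (half_return_equation_sum p q b m rho Hm Hs 0) as [dM [HdM _]].
    - rewrite Rabs_R0. exact Hrho.
    - apply (ex_derive_continuous M 0). now exists dM. }
  destruct (Hc (fun y => Rabs (y + lam) < lam)) as [e He].
  { exists (mkposreal lam Hlam). intros y Hy. rewrite HM0 in Hy.
    unfold ball in Hy; simpl in Hy.
    unfold AbsRing_ball, abs, minus, plus, opp in Hy; simpl in Hy.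
    now rewrite Ropp_involutive in Hy. }
  (* Since [Rabs (M v) < 2 * lam], this bound on [v] gives [Rabs (c * w) < 1] for [w = v] and
     [w = v * M v]. The case [c = k] serves the arctangents, the case [c = b] the direction of
     crossing at both ends of the arc. *)
  set (d3 := / ((1 + Rabs k + Rabs b) * (1 + 2 * lam))).
  assert (Hk := Rabs_pos k). assert (Hb := Rabs_pos b).
  assert (Hd3 : 0 < d3).
  { apply Rinv_0_lt_compat. apply Rmult_lt_0_compat; lra. }
  assert (Hd3' : d3 * ((1 + Rabs k + Rabs b) * (1 + 2 * lam)) = 1).
  { unfold d3. field. split; nra. }
  set (delta := Rmin (Rmin rho e) d3).
  assert (Hdr : delta <= rho /\ delta <= e /\ delta <= d3).
  { unfold delta. pose proof (Rmin_l (Rmin rho e) d3).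
    pose proof (Rmin_r (Rmin rho e) d3).
    pose proof (Rmin_l rho e). pose proof (Rmin_r rho e). lra. }
  assert (Hdelta : 0 < delta).
  { unfold delta. repeat apply Rmin_glb_lt; try easy. apply e. }
  exists m, delta. repeat split; try easy.
  assert (Hloc : forall v, 0 <= v < delta -> M v < 0 /\
     forall c, Rabs c <= Rabs k + Rabs b -> 0 < 1 + c * v /\ 0 < 1 + c * (v * M v)).
  { intros v Hv.
    assert (HMv : Rabs (M v + lam) < lam).
    { apply He. unfold ball; simpl.
      unfold AbsRing_ball, abs, minus, plus, opp; simpl.
      rewrite Ropp_0, Rplus_0_r, Rabs_pos_eq; lra. }
    apply Rabs_def2 in HMv.
    split; [lra|]. intros c Hcc.
    assert (Hcv : forall w, Rabs w <= (1 + 2 * lam) * v -> 0 < 1 + c * w).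
    { intros w Hw.
      assert (Rabs (c * w) < 1).
      { rewrite Rabs_mult. apply Rle_lt_trans with ((Rabs k + Rabs b) * ((1 + 2 * lam) * v)).
        - apply Rmult_le_compat; auto using Rabs_pos.
        - apply Rle_lt_trans with ((Rabs k + Rabs b) * ((1 + 2 * lam) * d3)).
          + apply Rmult_le_compat_l; [lra|]. apply Rmult_le_compat_l; lra.
          + nra. }
      apply Rabs_def2 in H. lra. }
    split; apply Hcv.
    - rewrite Rabs_pos_eq by lra. nra.
    - rewrite Rabs_mult, (Rabs_pos_eq v), (Rabs_left (M v)) by lra. nra. }
  intros u Hu.
  assert (Hmu : M u < 0) by (apply Hloc; lra).
  exists (M u), (PI + atan (x * (u * M u) / (1 + k * (u * M u)))
            - atan (x * u / (1 + k * u))).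
  destruct (Hloc u ltac:(lra)) as [_ Hpos].
  destruct (Hpos k ltac:(lra)) as [Hk0 Hk1].
  destruct (Hpos b ltac:(lra)) as [Hb0 Hb1].
  assert (Hum : u * M u < 0) by nra.
  assert (Hplus : forall c, 0 < 1 + c * u -> 0 < / u + c).
  { intros c Hcu. replace (/ u + c) with ((1 + c * u) / u) by (field; lra).
    apply Rdiv_lt_0_compat; lra. }
  assert (Hminus : forall c, 0 < 1 + c * (u * M u) -> / (u * M u) + c < 0).
  { intros c Hcu. replace (/ (u * M u) + c) with (- ((1 + c * (u * M u)) / - (u * M u)))
      by (field; split; lra).
    apply Ropp_lt_gt_0_contravar. apply Rdiv_lt_0_compat; lra. }
  assert (HI : / 2 * ln (quad k x (u * M u)) - / 2 * ln (quad k x u) - ln (- M u)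
     = g * (PI + atan (x * (u * M u) / (1 + k * (u * M u)))
            - atan (x * u / (1 + k * u)))).
  { apply (half_return_integral g x b M u); [lra|exact HM0|].
    intros v Hv. destruct (Hloc v ltac:(lra)) as [Hv0 Hv1].
    destruct (Hv1 k ltac:(lra)). repeat split; try easy.
    destruct (half_return_equation_sum p q b m rho Hm Hs v) as [dM HdM].
    { rewrite Rabs_pos_eq; lra. }
    exists dM. exact HdM. }
  destruct (half_return_closing g x b (M u) u ltac:(lra) Hmu Hk0 Hk1 HI)
    as [HT [HT1 HT2]].
  repeat split; auto; try lra; [|exact (proj1 HT)|exact (proj2 HT)].
  apply Hs. rewrite Rabs_pos_eq; lra.
Qed.

(** * Orbits of the linear systems *)

Definition solves_at (f : R * R -> R * R) (z : R -> R * R) (t : R) : Prop :=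
  is_derive (fun s => fst (z s)) t (fst (f (z t))) /\
  is_derive (fun s => snd (z s)) t (snd (f (z t))).

Definition continuous_at (z : R -> R * R) (t : R) : Prop :=
  continuous (fun s => fst (z s)) t /\ continuous (fun s => snd (z s)) t.

Lemma solves_at_continuous (f : R * R -> R * R) (z : R -> R * R) (t : R) :
  solves_at f z t -> continuous_at z t.
Proof.
  intros [H1 H2]. split.
  - apply (ex_derive_continuous (fun s => fst (z s)) t). eexists; exact H1.
  - apply (ex_derive_continuous (fun s => snd (z s)) t). eexists; exact H2.
Qed.

(* [a] is the abscissa of the equilibrium. *)
Definition lin (g a b : R) : R * R -> R * R := left_field g (a * (1 + g ^ 2)) b.

(* With [X = x - a] and [N = g X - (y - y_a)] the system is a rotation of
   angular speed 1 combined with the homothety of ratio [exp (g t)]. *)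
Definition coordN (g a b : R) (p : R * R) : R :=
  g * (fst p - a) - (snd p - (2 * g * a - b)).

Definition flow (g a b : R) (p : R * R) (t : R) : R * R :=
  let X := exp (g * t) * ((fst p - a) * cos t + coordN g a b p * sin t) in
  let N := exp (g * t) * (coordN g a b p * cos t - (fst p - a) * sin t) in
  (a + X, 2 * g * a - b + g * X - N).

Lemma flow_solves (g a b : R) (p : R * R) : solves (lin g a b) (flow g a b p).
Proof.
  intros t. unfold lin, left_field, flow; simpl fst; simpl snd. split.
  - auto_derive; [easy|]. ring.
  - auto_derive; [easy|]. ring.
Qed.

Lemma flow_0 (g a b : R) (p : R * R) : flow g a b p 0 = p.
Proof.
  destruct p as [x y]. unfold flow, coordN; simpl.
  rewrite Rmult_0_r, exp_0, cos_0, sin_0. f_equal; ring.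
Qed.

(** [E1] and [E2] are the rotating coordinates pulled back to time 0 by the inverse flow. The
    equation is asked for on the open interval only, since a Filippov trajectory need not solve the
    linear system at the times when it is on the line [x = 0]. *)
Lemma lin_invariants (g a b : R) (x y : R -> R) (s t : R) :
  s <= t ->
  (forall v, s < v < t ->
     is_derive x v (2 * g * x v - y v - b) /\
     is_derive y v ((1 + g ^ 2) * x v - a * (1 + g ^ 2))) ->
  (forall v, s <= v <= t -> continuous x v /\ continuous y v) ->
  let N := fun v => g * (x v - a) - (y v - (2 * g * a - b)) in
  let E1 := fun v => exp (- g * v) * ((x v - a) * cos v - N v * sin v) in
  let E2 := fun v => exp (- g * v) * ((x v - a) * sin v + N v * cos v) in
  E1 t = E1 s /\ E2 t = E2 s.
Proof.
  intros Hst Hd Hc N E1 E2.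
  assert (Hexp : forall v, continuous (fun v => exp (- g * v)) v).
  { intros v. apply (ex_derive_continuous (fun v => exp (- g * v)) v).
    auto_derive. easy. }
  assert (Hx : forall v, s <= v <= t -> continuous (fun v => x v - a) v).
  { intros v Hv. apply (continuous_minus x (fun _ => a)); [now apply Hc|].
    apply continuous_const. }
  assert (HN : forall v, s <= v <= t -> continuous N v).
  { intros v Hv. apply (continuous_minus (fun v => g * (x v - a))
      (fun v => y v - (2 * g * a - b))).
    - apply (continuous_mult (fun _ => g)); [apply continuous_const|now apply Hx].
    - apply (continuous_minus y (fun _ => 2 * g * a - b)); [now apply Hc|].
      apply continuous_const. }
  assert (Hcos := continuous_cos). assert (Hsin := continuous_sin).
  split; apply const_on_segment; try easy.
  - intros v Hv. destruct (Hd v Hv) as [H1 H2]. unfold E1, N. auto_derive.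
    + repeat split; try easy; eexists; eassumption.
    + rewrite (Derive_ext (fun u => x u) x v), (Derive_ext (fun u => y u) y v) by easy.
      rewrite (is_derive_unique _ _ _ H1), (is_derive_unique _ _ _ H2). ring.
  - intros v Hv. apply (continuous_mult (fun v => exp (- g * v))
      (fun v => (x v - a) * cos v - N v * sin v)); [apply Hexp|].
    apply (continuous_minus (fun v => (x v - a) * cos v) (fun v => N v * sin v)).
    + apply (continuous_mult (fun v => x v - a) cos); auto.
    + apply (continuous_mult N sin); auto.
  - intros v Hv. destruct (Hd v Hv) as [H1 H2]. unfold E2, N. auto_derive.
    + repeat split; try easy; eexists; eassumption.
    + rewrite (Derive_ext (fun u => x u) x v), (Derive_ext (fun u => y u) y v) by easy.
      rewrite (is_derive_unique _ _ _ H1), (is_derive_unique _ _ _ H2). ring.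
  - intros v Hv. apply (continuous_mult (fun v => exp (- g * v))
      (fun v => (x v - a) * sin v + N v * cos v)); [apply Hexp|].
    apply (continuous_plus (fun v => (x v - a) * sin v) (fun v => N v * cos v)).
    + apply (continuous_mult (fun v => x v - a) sin); auto.
    + apply (continuous_mult N cos); auto.
Qed.

Lemma lin_unique (g a b : R) (z w : R -> R * R) (s t : R) :
  s <= t ->
  (forall v, s < v < t -> solves_at (lin g a b) z v /\ solves_at (lin g a b) w v) ->
  (forall v, s <= v <= t -> continuous_at z v /\ continuous_at w v) ->
  z s = w s -> z t = w t.
Proof.
  intros Hst Hd Hc H0.
  destruct (lin_invariants g a b (fun v => fst (z v)) (fun v => snd (z v)) s t Hst)
    as [Hz1 Hz2].
  { intros v Hv. apply Hd, Hv. }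
  { intros v Hv. apply Hc, Hv. }
  destruct (lin_invariants g a b (fun v => fst (w v)) (fun v => snd (w v)) s t Hst)
    as [Hw1 Hw2].
  { intros v Hv. apply Hd, Hv. }
  { intros v Hv. apply Hc, Hv. }
  rewrite H0 in Hz1, Hz2. rewrite <- Hw1 in Hz1. rewrite <- Hw2 in Hz2.
  apply Rmult_eq_reg_l in Hz1; [|apply Rgt_not_eq, exp_pos].
  apply Rmult_eq_reg_l in Hz2; [|apply Rgt_not_eq, exp_pos].
  destruct (z t) as [x y], (w t) as [x' y']; simpl in Hz1, Hz2.
  pose proof (sin2_cos2 t) as Hsc. unfold Rsqr in Hsc.
  assert (Hinv : forall A B C D, A * cos t - B * sin t = C * cos t - D * sin t ->
    A * sin t + B * cos t = C * sin t + D * cos t -> A = C /\ B = D).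
  { intros A B C D HA HB. split.
    - replace A with ((A * cos t - B * sin t) * cos t + (A * sin t + B * cos t) * sin t)
        by (transitivity (A * (sin t * sin t + cos t * cos t)); [ring|rewrite Hsc; ring]).
      rewrite HA, HB.
      transitivity (C * (sin t * sin t + cos t * cos t)); [ring|rewrite Hsc; ring].
    - replace B with ((A * sin t + B * cos t) * cos t - (A * cos t - B * sin t) * sin t)
        by (transitivity (B * (sin t * sin t + cos t * cos t)); [ring|rewrite Hsc; ring]).
      rewrite HA, HB.
      transitivity (D * (sin t * sin t + cos t * cos t)); [ring|rewrite Hsc; ring]. }
  destruct (Hinv _ _ _ _ Hz1 Hz2) as [H1 H2].
  assert (x = x') by lra. subst x'. f_equal. lra.
Qed.

Lemma solves_shift (g a b : R) (z : R -> R * R) (c : R) :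
  solves (lin g a b) z -> solves (lin g a b) (fun t => z (t + c)).
Proof.
  intros H t. destruct (H (t + c)) as [H1 H2].
  assert (Hc : is_derive (fun s => s + c) t 1) by (auto_derive; [easy|ring]).
  split.
  - pose proof (is_derive_comp (fun s => fst (z s)) (fun s => s + c) t _ _ H1 Hc) as H3.
    unfold scal in H3; simpl in H3; unfold mult in H3; simpl in H3.
    now rewrite Rmult_1_l in H3.
  - pose proof (is_derive_comp (fun s => snd (z s)) (fun s => s + c) t _ _ H2 Hc) as H3.
    unfold scal in H3; simpl in H3; unfold mult in H3; simpl in H3.
    now rewrite Rmult_1_l in H3.
Qed.

Lemma solves_flow (g a b : R) (z : R -> R * R) (t : R) :
  solves (lin g a b) z -> 0 <= t -> z t = flow g a b (z 0) t.
Proof.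
  intros Hz Ht.
  assert (Hf := flow_solves g a b (z 0)).
  apply (lin_unique g a b z (flow g a b (z 0)) 0 t Ht).
  - intros v _. split; [apply Hz|apply Hf].
  - intros v _. split; eapply solves_at_continuous; [apply Hz|apply Hf].
  - now rewrite flow_0.
Qed.

Lemma increment_pos (f df : R -> R) (s t : R) :
  s < t -> (forall v, is_derive f v (df v)) ->
  (forall v, s < v < t -> 0 < df v) -> f s < f t.
Proof.
  intros Hst Hd Hpos.
  destruct (MVT_cor2 f df s t Hst) as [c [Hc Hcst]].
  - intros v _. apply is_derive_Reals. apply Hd.
  - specialize (Hpos c Hcst). nra.
Qed.

(* The derivative [exp (g t) (C cos t + S sin t)] changes sign once on [(0, T)]. *)
Lemma sinusoidal_bump (h : R -> R) (g C S T : R) :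
  0 < C -> 0 < T < 2 * PI ->
  (forall t, is_derive h t (exp (g * t) * (C * cos t + S * sin t))) ->
  h 0 = 0 -> h T = 0 -> C * cos T + S * sin T < 0 ->
  forall t, 0 < t < T -> 0 < h t.
Proof.
  intros HC HT Hd H0 HhT HgT t Ht.
  set (phi := atan (S / C)).
  destruct (cos_sin_atan_ratio C S HC) as [Hc Hs]. fold phi in Hc, Hs.
  set (r := sqrt (C ^ 2 + S ^ 2)) in *.
  assert (Hr : 0 < r) by (apply sqrt_lt_R0; nra).
  assert (Hg : forall t, C * cos t + S * sin t = r * cos (t - phi)).
  { intros v. rewrite cos_minus, Hc, Hs. field. lra. }
  assert (Hphi := atan_bound (S / C)). fold phi in Hphi.
  rewrite Hg in HgT.
  assert (HTphi : T - phi < 3 * (PI / 2)).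
  { destruct (Rlt_le_dec (T - phi) (3 * (PI / 2))) as [Hlt|Hge]; [easy|].
    assert (0 <= cos (T - phi)); [|nra].
    replace (T - phi) with ((T - phi - 2 * PI) + 2 * INR 1 * PI)
      by (simpl; ring).
    rewrite cos_period. apply cos_ge_0; lra. }
  (* Up to [phi + PI / 2], where the cosine vanishes, [h] increases from 0; afterwards it decreases
     to [h T = 0]. *)
  destruct (Rle_lt_dec t (phi + PI / 2)) as [Hle|Hlt].
  - rewrite <- H0. apply increment_pos with (1 := proj1 Ht) (2 := Hd).
    intros v Hv. rewrite Hg. apply Rmult_lt_0_compat; [apply exp_pos|].
    apply Rmult_lt_0_compat; [easy|]. apply cos_gt_0; lra.
  - assert (- h t < - h T); [|lra].
    apply increment_pos with (f := fun v => - h v)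
      (df := fun v => - (exp (g * v) * (C * cos v + S * sin v))) (1 := proj2 Ht).
    + intros v. apply (is_derive_opp h v). apply Hd.
    + intros v Hv. rewrite Hg.
      assert (cos (v - phi) < 0) by (apply cos_lt_0; lra).
      assert (0 < r * - cos (v - phi)) by (apply Rmult_lt_0_compat; lra).
      pose proof (exp_pos (g * v)). nra.
Qed.

(** Strict negativity inside makes [T] the first return time, which yields the uniqueness of the
    arrival point; [T < 2 * PI] keeps the arc within one turn, where the homothety ratio is bounded
    below. *)
Definition left_arc (f : R * R -> R * R) (y0 y1 T : R) (z : R -> R * R) : Prop :=
  solves f z /\ 0 < T < 2 * PI /\ z 0 = (0, y0) /\ z T = (0, y1) /\
  forall t, 0 < t < T -> fst (z t) < 0.

Lemma left_arc_of_closing (g a b y0 y1 T : R) :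
  let k := b - g * a in
  0 < y0 + b -> y1 + b < 0 -> 0 < T < 2 * PI ->
  exp (g * T) * (a * cos T + (y0 + k) * sin T) = a ->
  exp (g * T) * ((y0 + k) * cos T - a * sin T) = y1 + k ->
  left_arc (lin g a b) y0 y1 T (flow g a b (0, y0)).
Proof.
  intros k H0 H1 HT Hsin Hcos.
  assert (HN : coordN g a b (0, y0) = - (y0 + k)).
  { unfold coordN, k; simpl. ring. }
  split; [apply flow_solves|]. split; [easy|]. split; [apply flow_0|].
  assert (HzT : flow g a b (0, y0) T = (0, y1)).
  { unfold flow. rewrite HN; simpl fst. f_equal.
    - rewrite <- Hsin at 1. ring.
    - replace (g * (exp (g * T) * ((0 - a) * cos T + - (y0 + k) * sin T)))
        with (- g * a) by (rewrite <- Hsin at 1; ring).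
      replace (exp (g * T) * (- (y0 + k) * cos T - (0 - a) * sin T))
        with (- (y1 + k)) by (rewrite <- Hcos; ring).
      unfold k. ring. }
  split; [easy|].
  intros t Ht.
  assert (Hd := flow_solves g a b (0, y0)).
  assert (0 < - fst (flow g a b (0, y0) t)); [|lra].
  apply (sinusoidal_bump (fun t => - fst (flow g a b (0, y0) t)) g
    (y0 + b) (g * (y0 + k) - a) T); try easy.
  - intros v. destruct (Hd v) as [Hv _].
    replace (exp (g * v) * ((y0 + b) * cos v + (g * (y0 + k) - a) * sin v))
      with (opp (fst (lin g a b (flow g a b (0, y0) v)))).
    + exact (is_derive_opp (fun s => fst (flow g a b (0, y0) s)) v _ Hv).
    + unfold opp, lin, left_field, flow; simpl. rewrite HN. unfold k. ring.
  - rewrite flow_0. simpl. ring.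
  - rewrite HzT. simpl. ring.
  (* By the two closing equations, the slope of [- x] at [T] is [g * a + (y1 + k) = y1 + b < 0]. *)
  - assert (He := exp_pos (g * T)).
    assert (exp (g * T) * ((y0 + b) * cos T + (g * (y0 + k) - a) * sin T) < 0);
      [|nra].
    replace (exp (g * T) * ((y0 + b) * cos T + (g * (y0 + k) - a) * sin T))
      with (g * (exp (g * T) * (a * cos T + (y0 + k) * sin T))
            + exp (g * T) * ((y0 + k) * cos T - a * sin T)) by (unfold k; ring).
    rewrite Hsin, Hcos. unfold k. lra.
Qed.

Lemma derive_pos_right (f : R -> R) (t l : R) :
  is_derive f t l -> 0 < l ->
  exists d, 0 < d /\ forall s, t < s < t + d -> f t < f s.
Proof.
  intros Hf Hl. apply is_derive_Reals in Hf.
  destruct (Hf l Hl) as [d Hd].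
  exists d. split; [apply cond_pos|]. intros s Hs.
  specialize (Hd (s - t)).
  replace (t + (s - t)) with s in Hd by ring.
  assert (Habs : Rabs ((f s - f t) / (s - t) - l) < l).
  { apply Hd; [lra|]. rewrite Rabs_pos_eq; lra. }
  apply Rabs_def2 in Habs.
  assert (0 < (f s - f t) / (s - t)) by lra.
  assert (f s - f t = (f s - f t) / (s - t) * (s - t)) by (field; lra).
  nra.
Qed.

(** A competing arrival before [T] is impossible because the arc is then strictly inside the
    half-plane. One after [T] is impossible because x' = - y1 - b > 0 at [T] pushes the orbit out of
    [x <= 0]. *)
Lemma left_return_unique (g a b y0 y1 T y' : R) (z : R -> R * R) :
  left_arc (lin g a b) y0 y1 T z -> y1 + b < 0 ->
  left_return (lin g a b) y0 y' -> y' = y1.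
Proof.
  intros [Hz [HT [Hz0 [HzT Hneg]]]] Hy1 [Hy' [w [T' [Hw [HT' [Hw0 [HwT' Hle]]]]]]].
  assert (Hzw : forall t, 0 <= t -> w t = z t).
  { intros t Ht. rewrite (solves_flow g a b w t Hw Ht), (solves_flow g a b z t Hz Ht).
    now rewrite Hz0, Hw0. }
  destruct (Rtotal_order T' T) as [h|[h|h]].
  - specialize (Hneg T' (conj HT' h)). rewrite <- Hzw, HwT' in Hneg by lra.
    simpl in Hneg. lra.
  - subst T'. rewrite Hzw, HzT in HwT' by lra. now inversion HwT'.
  - exfalso. destruct (Hz T) as [Hd _].
    destruct (derive_pos_right _ _ _ Hd) as [d [Hd0 Hd1]].
    { rewrite HzT. unfold lin, left_field; simpl. lra. }
    set (s := Rmin (T + d / 2) T').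
    assert (Hs : T < s <= T' /\ s < T + d).
    { unfold s. pose proof (Rmin_l (T + d / 2) T'). pose proof (Rmin_r (T + d / 2) T').
      pose proof (Rmin_glb_lt (T + d / 2) T' T ltac:(lra) ltac:(lra)). lra. }
    specialize (Hd1 s ltac:(lra)). rewrite HzT in Hd1. simpl in Hd1.
    specialize (Hle s ltac:(lra)). rewrite Hzw in Hle by lra. lra.
Qed.

Lemma left_arc_return (f : R * R -> R * R) (y0 y1 T : R) (z : R -> R * R) :
  left_arc f y0 y1 T z -> y1 < 0 -> left_return f y0 y1.
Proof.
  intros [Hz [HT [Hz0 [HzT Hneg]]]] Hy1. split; [easy|].
  exists z, T. repeat split; try easy; try apply Hz; try lra.
  intros t Ht. destruct (Req_dec t 0) as [->|h0]; [rewrite Hz0; simpl; lra|].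
  destruct (Req_dec t T) as [->|h1]; [rewrite HzT; simpl; lra|].
  left. apply Hneg. lra.
Qed.

(** * The displacement series *)

Lemma left_half_return (g a b : R) :
  let k := b - g * a in
  let p := 2 * k in
  let q := k ^ 2 + a ^ 2 in
  exists (m : nat -> R) (delta : R),
    m 0%nat = - exp (- g * PI) /\
    (forall n, INR (S n) * m (S n) = eq_rhs p q b m n) /\
    0 < delta /\
    forall u, 0 < u < delta ->
    exists (y1 T : R) (z : R -> R * R),
      y1 < 0 /\ y1 + b < 0 /\ left_arc (lin g a b) (/ u) y1 T z /\
      is_pseries (shift m) u (/ y1).
Proof.
  intros k p q.
  destruct (half_return_series g a b) as [m [delta [Hm0 [Hm [Hd H]]]]].
  exists m, delta. repeat split; try easy.
  intros u Hu. destruct (H u Hu) as [mu [T [Hmu [Hneg [HT [H1 [H2 [H3 [H4 [H5 H6]]]]]]]]]].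
  exists (/ (u * mu)), T, (flow g a b (0, / u)).
  split; [|split; [easy|split]].
  - apply Rinv_lt_0_compat. nra.
  - now apply left_arc_of_closing.
  - rewrite Rinv_inv.
    apply is_pseries_ext with (PS_incr_1 m).
    + now intros [|n].
    + exact (is_pseries_incr_1 m u mu Hmu).
Qed.

Definition rin (g a b : R) : R * R -> R * R := right_field g (a * (1 + g ^ 2)) b.

Definition refl (z : R -> R * R) (t : R) : R * R := (- fst (z (- t)), snd (z (- t))).

Lemma is_derive_eq (f : R -> R) (t l l' : R) :
  is_derive f t l -> l = l' -> is_derive f t l'.
Proof. now intros H <-. Qed.

Lemma is_derive_reverse (f : R -> R) (t l : R) :
  is_derive f (- t) l -> is_derive (fun s => f (- s)) t (- l).
Proof.
  intros H.
  assert (Hc : is_derive (fun s => - s) t (- 1)) by (auto_derive; [easy|ring]).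
  pose proof (is_derive_comp f (fun s => - s) t _ _ H Hc) as H3.
  replace (- l) with (scal (- 1) l); [exact H3|].
  unfold scal; simpl; unfold mult; simpl. ring.
Qed.

Lemma refl_solves_lin (g a b : R) (z : R -> R * R) :
  solves (rin g a b) z -> solves (lin (- g) (- a) (- b)) (refl z).
Proof.
  intros H t. destruct (H (- t)) as [H1 H2]. unfold refl; simpl. split.
  - apply is_derive_reverse in H1.
    apply (is_derive_opp (fun s => fst (z (- s)))) in H1.
    apply (is_derive_eq _ _ _ _ H1).
    unfold opp, lin, rin, left_field, right_field; simpl. ring.
  - apply (is_derive_reverse (fun s => snd (z s))) in H2.
    apply (is_derive_eq _ _ _ _ H2).
    unfold lin, rin, left_field, right_field; simpl. ring.
Qed.

Lemma refl_solves_rin (g a b : R) (z : R -> R * R) :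
  solves (lin (- g) (- a) (- b)) z -> solves (rin g a b) (refl z).
Proof.
  intros H t. destruct (H (- t)) as [H1 H2]. unfold refl; simpl. split.
  - apply is_derive_reverse in H1.
    apply (is_derive_opp (fun s => fst (z (- s)))) in H1.
    apply (is_derive_eq _ _ _ _ H1).
    unfold opp, lin, rin, left_field, right_field; simpl. ring.
  - apply (is_derive_reverse (fun s => snd (z s))) in H2.
    apply (is_derive_eq _ _ _ _ H2).
    unfold lin, rin, left_field, right_field; simpl. ring.
Qed.

Lemma right_return_reflected (g a b y0 y2 : R) :
  right_return (rin g a b) y0 y2 <-> left_return (lin (- g) (- a) (- b)) y0 y2.
Proof.
  split; intros [Hy [z [T [Hz [HT [H0 [H1 H2]]]]]]]; (split; [easy|]);
    exists (refl z), T.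
  - split; [now apply refl_solves_lin|]. unfold refl.
    split; [easy|]. split; [|split].
    + rewrite Ropp_0, H0; simpl. now rewrite Ropp_0.
    + rewrite H1; simpl. now rewrite Ropp_0.
    + intros t Ht; simpl. specialize (H2 (- t) ltac:(lra)). lra.
  - split; [now apply refl_solves_rin|]. unfold refl.
    split; [easy|]. split; [|split].
    + rewrite Ropp_0, H0; simpl. now rewrite Ropp_0.
    + rewrite Ropp_involutive, H1; simpl. now rewrite Ropp_0.
    + intros t Ht; simpl. specialize (H2 (- t) ltac:(lra)). lra.
Qed.

Lemma ord1_eq (g a b y0 y1 T : R) (z : R -> R * R) :
  left_arc (lin g a b) y0 y1 T z -> y1 < 0 -> y1 + b < 0 ->
  ord1 (lin g a b) y0 = y1 /\ exists! y, left_return (lin g a b) y0 y.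
Proof.
  intros Harc H1 H2.
  assert (Hr := left_arc_return _ _ _ _ _ Harc H1).
  split.
  - apply (iota_unique (fun y => left_return (lin g a b) y0 y)); [|easy].
    intros y. now apply left_return_unique with (1 := Harc).
  - exists y1. split; [easy|].
    intros y Hy. symmetry. now apply left_return_unique with (1 := Harc) (3 := Hy).
Qed.

Lemma ord2_eq (g a b y0 y1 T : R) (z : R -> R * R) :
  left_arc (lin (- g) (- a) (- b)) y0 y1 T z -> y1 < 0 -> y1 + - b < 0 ->
  ord2 (rin g a b) y0 = y1 /\ exists! y, right_return (rin g a b) y0 y.
Proof.
  intros Harc H1 H2.
  destruct (ord1_eq _ _ _ _ _ _ _ Harc H1 H2) as [H3 [y [Hy Hu]]].
  assert (Hr := left_arc_return _ _ _ _ _ Harc H1).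
  split.
  - apply (iota_unique (fun y => right_return (rin g a b) y0 y)).
    + intros y' Hy'. apply right_return_reflected in Hy'.
      now apply left_return_unique with (1 := Harc).
    + now apply right_return_reflected.
  - exists y. split; [now apply right_return_reflected|].
    intros y' Hy'. apply Hu. now apply right_return_reflected.
Qed.

(** [D u / u ^ S k] is again the sum of a power series, continuous at 0 with value [c (S k)], and
    therefore keeps the sign of this value for small [u > 0]. *)
Lemma leading_coefficient_sign (c : nat -> R) (D : R -> R) (eps : R) (k : nat) :
  0 < eps -> (forall u, 0 < u < eps -> is_pseries c u (D u)) ->
  (forall i, (i <= k)%nat -> c i = 0) -> c (S k) <> 0 ->
  exists delta, 0 < delta /\ forall u, 0 < u < delta -> 0 < D u * c (S k).
Proof.
  intros Heps Hser Hz Hk.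
  set (d := PS_decr_n c (S k)).
  assert (Hd : forall u, 0 < u < eps -> is_pseries d u (D u / u ^ S k)).
  { intros u Hu.
    assert (Hinv : mult (/ u) u = one).
    { unfold mult, one; simpl. field. lra. }
    pose proof (is_pseries_decr_n c (S k) u (/ u) (D u) Hinv ltac:(lia) (Hser u Hu)) as H.
    fold d in H.
    replace (D u / u ^ S k) with (scal (pow_n (/ u) (S k))
      (plus (D u) (opp (sum_n (fun k0 : nat => scal (pow_n u k0) (c k0)) (S k - 1))))); [exact H|].
    rewrite (sum_n_ext_loc _ (fun _ => 0)).
    2:{ intros i Hi. rewrite Hz by (simpl in Hi; lia).
        change (pow_n u i * 0 = 0). ring. }
    rewrite sum_n_const, Rmult_0_r.
    rewrite pow_n_pow, pow_inv.
    unfold scal, plus, opp; simpl; unfold mult; simpl. field.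
    split; [|lra]. apply pow_nonzero; lra. }
  (* Convergence is given on the right of 0 only; the single point [eps / 2] already bounds the
     radius from below. *)
  assert (Hcv : Rbar_lt (Rabs 0) (CV_radius d)).
  { apply (sums_to_radius (eps / 2) d (PSeries d)); [|rewrite Rabs_R0; lra].
    intros u Hu. apply PSeries_correct.
    apply CV_radius_inside.
    apply Rbar_lt_le_trans with (Rabs (eps / 2)).
    { simpl. rewrite (Rabs_pos_eq (eps / 2)); lra. }
    destruct (Rbar_le_lt_dec (Rabs (eps / 2)) (CV_radius d)) as [h|h]; [easy|].
    exfalso. apply (CV_disk_outside _ _ h).
    apply ex_series_lim_0. exists (D (eps/2) / (eps/2) ^ S k).
    eapply is_series_ext; [|apply (Hd (eps / 2)); lra].
    intros n. unfold scal; simpl; unfold mult; simpl.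
    rewrite pow_n_pow. ring. }
  assert (Hc : continuous (PSeries d) 0).
  { apply (ex_derive_continuous (PSeries d) 0).
    eexists. now apply is_derive_PSeries. }
  assert (Hd0 : PSeries d 0 = c (S k)).
  { rewrite PSeries_0. unfold d, PS_decr_n. f_equal. lia. }
  destruct (Hc (fun y => 0 < y * c (S k))) as [e He].
  { assert (Hpos : 0 < Rabs (c (S k))) by now apply Rabs_pos_lt.
    exists (mkposreal _ Hpos). intros y Hy. rewrite Hd0 in Hy.
    unfold ball in Hy; simpl in Hy.
    unfold AbsRing_ball, abs, minus, plus, opp in Hy; simpl in Hy.
    apply Rabs_def2 in Hy.
    destruct (Rlt_le_dec 0 (c (S k))) as [h|h].
    - rewrite Rabs_pos_eq in Hy by lra. nra.
    - rewrite Rabs_left in Hy by lra. nra. }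
  exists (Rmin eps e). split; [apply Rmin_glb_lt; [easy|apply cond_pos]|].
  intros u Hu.
  assert (Hue : u < eps /\ u < e).
  { pose proof (Rmin_l eps e). pose proof (Rmin_r eps e). lra. }
  assert (Hp : 0 < PSeries d u * c (S k)).
  { apply He. unfold ball; simpl. unfold AbsRing_ball, abs, minus, plus, opp; simpl.
    rewrite Ropp_0, Rplus_0_r, Rabs_pos_eq; lra. }
  rewrite (is_pseries_unique _ _ _ (Hd u ltac:(lra))) in Hp.
  assert (Huk : 0 < u ^ S k) by (apply pow_lt; lra).
  replace (D u * c (S k)) with (D u / u ^ S k * c (S k) * u ^ S k) by (field; lra).
  now apply Rmult_lt_0_compat.
Qed.

Lemma displacement_expansion (gL gR aL aR b : R) :
  let kL := b - gL * aL in
  let kR := - b - gR * aR in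
  let fL := lin gL aL b in
  let fR := rin gR aR b in
  returns_well_defined fL fR /\
  exists (mL mR : nat -> R) (eps : R),
    mL 0%nat = - exp (- gL * PI) /\ mR 0%nat = - exp (gR * PI) /\
    (forall n, INR (S n) * mL (S n) = eq_rhs (2 * kL) (kL ^ 2 + aL ^ 2) b mL n) /\
    (forall n, INR (S n) * mR (S n) = eq_rhs (2 * kR) (kR ^ 2 + aR ^ 2) (- b) mR n) /\
    0 < eps /\ forall u, 0 < u < eps ->
      is_pseries (fun n => shift mL n - shift mR n) u (Defs.Delta fL fR u) /\
      ord1 fL (/ u) < 0 /\ ord2 fR (/ u) < 0.
Proof.
  intros kL kR fL fR.
  destruct (left_half_return gL aL b) as [mL [dL [HmL0 [HmL [HdL HL]]]]].
  destruct (left_half_return (- gR) (- aR) (- b)) as [mR [dR [HmR0 [HmR [HdR HR]]]]].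
  set (eps := Rmin dL dR).
  assert (Heps : 0 < eps) by now apply Rmin_glb_lt.
  assert (Hle : eps <= dL /\ eps <= dR) by (split; [apply Rmin_l|apply Rmin_r]).
  assert (Hall : forall u, 0 < u < eps -> exists y1 y2,
    ord1 fL (/ u) = y1 /\ ord2 fR (/ u) = y2 /\ y1 < 0 /\ y2 < 0 /\
    is_pseries (shift mL) u (/ y1) /\ is_pseries (shift mR) u (/ y2) /\
    (exists! y, left_return fL (/ u) y) /\ (exists! y, right_return fR (/ u) y)).
  { intros u Hu.
    destruct (HL u ltac:(lra)) as [y1 [T1 [z1 [H1 [H1b [Harc1 Hs1]]]]]].
    destruct (HR u ltac:(lra)) as [y2 [T2 [z2 [H2 [H2b [Harc2 Hs2]]]]]].
    destruct (ord1_eq _ _ _ _ _ _ _ Harc1 H1 H1b).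
    destruct (ord2_eq _ _ _ _ _ _ _ Harc2 H2 H2b).
    exists y1, y2. now repeat split. }
  split.
  - exists (/ eps). split; [now apply Rinv_0_lt_compat|].
    intros y0 Hy0. assert (0 < / eps) by now apply Rinv_0_lt_compat.
    destruct (Hall (/ y0)) as [y1 [y2 [_ [_ [_ [_ [_ [_ [Hu1 Hu2]]]]]]]]].
    { split; [apply Rinv_0_lt_compat; lra|].
      rewrite <- (Rinv_inv eps). apply Rinv_lt_contravar; [nra|easy]. }
    now rewrite Rinv_inv in Hu1, Hu2.
  - exists mL, mR, eps. split; [easy|]. split.
    { rewrite HmR0. do 2 f_equal. ring. }
    split; [exact HmL|]. split.
    { intros n. rewrite HmR. unfold kR. do 2 f_equal; ring. }
    split; [easy|]. intros u Hu.
    destruct (Hall u Hu) as [y1 [y2 [E1 [E2 [H1 [H2 [Hs1 [Hs2 _]]]]]]]].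
    rewrite E1, E2. split; [|easy].
    unfold Defs.Delta, Lmap, Rmap. rewrite E1, E2.
    exact (is_pseries_minus (shift mL) (shift mR) u _ _ Hs1 Hs2).
Qed.

(** Since L = u m, the term [m n] enters the displacement coefficient of index [n + 1]. With
    [p = 2 * (b - g * a)] one has [p - b = - (2 * g * a - b)], so the hypothesis [p = b] says that
    the equilibrium has ordinate 0, as in case (c). *)
Lemma half_return_coefficients (p q b : R) (m : nat -> R) :
  (forall n, INR (S n) * m (S n) = eq_rhs p q b m n) ->
  let l := m 0%nat in
  m 1%nat = l * (l - 1) * (p - b) /\
  m 2%nat = / 2 * (l * (m 1%nat * (p - b) + q * (l ^ 2 - 1))
                   + m 1%nat * ((l - 1) * (p - b) - (p + b * l))) /\
  (p = b -> m 3%nat = - / 3 * (b * q * l * (l ^ 3 - 1))).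
Proof.
  intros Hm l.
  assert (H1 : m 1%nat = l * (l - 1) * (p - b)).
  { pose proof (Hm 0%nat) as H.
    unfold eq_rhs, eq_K, eq_G, PS_mult in H; simpl in H. unfold l. lra. }
  assert (H2 : m 2%nat = / 2 * (l * (m 1%nat * (p - b) + q * (l ^ 2 - 1))
                   + m 1%nat * ((l - 1) * (p - b) - (p + b * l)))).
  { pose proof (Hm 1%nat) as H.
    unfold eq_rhs, eq_K, eq_G, PS_mult in H; simpl in H. unfold l. lra. }
  split; [easy|]. split; [easy|]. intros Hpb.
  rewrite Hpb in H1, H2.
  assert (H1' : m 1%nat = 0) by (rewrite H1; ring).
  rewrite H1' in H2.
  pose proof (Hm 2%nat) as H.
  unfold eq_rhs, eq_K, eq_G, PS_mult in H; simpl in H.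
  fold l in H. rewrite Hpb, H1', H2 in H.
  match type of H with _ = ?A => replace A with (- (b * q * l * (l ^ 3 - 1))) in H by field end.
  lra.
Qed.

(** Both arrival ordinates are negative, so 1/y1 - 1/y2 = (y2 - y1) / (y1 y2) has the sign of y2 -
    y1: a positive leading coefficient means stability. *)
Lemma order_and_stability (fL fR : R * R -> R * R) (c : nat -> R) (eps : R) (k : nat) :
  0 < eps ->
  (forall u, 0 < u < eps -> is_pseries c u (Defs.Delta fL fR u) /\
     ord1 fL (/ u) < 0 /\ ord2 fR (/ u) < 0) ->
  (forall i, (i <= k)%nat -> c i = 0) -> c (S k) <> 0 ->
  displacement_series fL fR c /\
  (0 < c (S k) -> stable_at_infinity fL fR) /\
  (c (S k) < 0 -> unstable_at_infinity fL fR).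
Proof.
  intros Heps Hs Hz Hk. split.
  { split; [apply Hz; lia|]. exists eps. split; [easy|]. intros u Hu. now apply Hs. }
  destruct (leading_coefficient_sign c (Defs.Delta fL fR) eps k Heps) as [d [Hd Hsign]];
    try easy.
  { intros u Hu. now apply Hs. }
  assert (Hd' : 0 < Rmin eps d) by now apply Rmin_glb_lt.
  assert (Hord : forall u, 0 < u < Rmin eps d ->
     0 < (ord2 fR (/ u) - ord1 fL (/ u)) * c (S k)).
  { intros u Hu.
    pose proof (Rmin_l eps d). pose proof (Rmin_r eps d).
    destruct (Hs u ltac:(lra)) as [_ [H1 H2]].
    specialize (Hsign u ltac:(lra)). unfold Defs.Delta, Lmap, Rmap in Hsign.
    set (y1 := ord1 fL (/ u)) in *. set (y2 := ord2 fR (/ u)) in *.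
    assert (0 < y1 * y2) by nra.
    replace ((y2 - y1) * c (S k)) with ((/ y1 - / y2) * c (S k) * (y1 * y2))
      by (field; lra).
    now apply Rmult_lt_0_compat. }
  split; intros Hc; exists (Rmin eps d); (split; [easy|]); intros u Hu;
    specialize (Hord u Hu); nra.
Qed.

(** Hyperbolicity asserts that some displacement series has a nonzero first coefficient, so refuting
    it needs all such series to share that coefficient. The difference of two of them sums to 0,
    which excludes a nonzero leading term. *)
Lemma first_coefficient_unique (fL fR : R * R -> R * R) (c c' : nat -> R) :
  displacement_series fL fR c -> displacement_series fL fR c' -> c 1%nat = c' 1%nat.
Proof.
  intros [H0 [e [He Hc]]] [H0' [e' [He' Hc']]].
  destruct (Req_dec (c 1%nat) (c' 1%nat)) as [h|h]; [easy|exfalso].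
  destruct (leading_coefficient_sign (fun n => c n - c' n) (fun _ => 0) (Rmin e e') 0)
    as [d [Hd Hsign]].
  - now apply Rmin_glb_lt.
  - intros u Hu. pose proof (Rmin_l e e'). pose proof (Rmin_r e e').
    pose proof (is_pseries_minus c c' u _ _ (Hc u ltac:(lra)) (Hc' u ltac:(lra))) as H2.
    rewrite <- (Rminus_diag_eq (Defs.Delta fL fR u) _ eq_refl). exact H2.
  - intros i Hi. replace i with 0%nat by lia. lra.
  - lra.
  - specialize (Hsign (d / 2) ltac:(lra)). lra.
Qed.

Lemma hyperbolic_case (gL gR aL aR b : R) :
  let fL := lin gL aL b in
  let fR := rin gR aR b in
  (gL + gR > 0 -> hyperbolic_at_infinity fL fR /\ stable_at_infinity fL fR) /\
  (gL + gR < 0 -> hyperbolic_at_infinity fL fR /\ unstable_at_infinity fL fR) /\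
  (gL + gR = 0 -> ~ hyperbolic_at_infinity fL fR).
Proof.
  intros fL fR.
  destruct (displacement_expansion gL gR aL aR b)
    as [_ [mL [mR [eps [HL0 [HR0 [_ [_ [Heps Hs]]]]]]]]].
  fold fL fR in Hs.
  set (c := fun n => shift mL n - shift mR n) in Hs.
  assert (Hc1 : c 1%nat = exp (gR * PI) - exp (- gL * PI)).
  { unfold c; simpl. rewrite HL0, HR0. ring. }
  pose proof PI_RGT_0.
  assert (Hz : forall i, (i <= 0)%nat -> c i = 0).
  { intros i Hi. replace i with 0%nat by lia. unfold c; simpl. ring. }
  repeat split.
  - assert (Hpos : 0 < c 1%nat).
    { rewrite Hc1. assert (exp (- gL * PI) < exp (gR * PI)); [|lra].
      apply exp_increasing. nra. }
    exists c. split; [|lra]. apply (order_and_stability fL fR c eps 0); try easy. lra.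
  - assert (Hpos : 0 < c 1%nat).
    { rewrite Hc1. assert (exp (- gL * PI) < exp (gR * PI)); [|lra].
      apply exp_increasing. nra. }
    apply (order_and_stability fL fR c eps 0); try easy. lra.
  - assert (Hneg : c 1%nat < 0).
    { rewrite Hc1. assert (exp (gR * PI) < exp (- gL * PI)); [|lra].
      apply exp_increasing. nra. }
    exists c. split; [|lra]. apply (order_and_stability fL fR c eps 0); try easy. lra.
  - assert (Hneg : c 1%nat < 0).
    { rewrite Hc1. assert (exp (gR * PI) < exp (- gL * PI)); [|lra].
      apply exp_increasing. nra. }
    apply (order_and_stability fL fR c eps 0); try easy. lra.
  - intros Hg [c' [Hc' Hc'1]]. apply Hc'1.
    rewrite (first_coefficient_unique fL fR c' c Hc').
    + rewrite Hc1. replace gR with (- gL) by lra. ring.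
    + split; [now apply Hz|]. exists eps. split; [easy|]. intros u Hu. now apply Hs.
Qed.

Lemma weak_focus_cases (gL gR aL aR b : R) :
  let fL := lin gL aL b in
  let fR := rin gR aR b in
  let yL := 2 * gL * aL - b in
  let yR := 2 * gR * aR + b in
  gL = - gR ->
  (yL - yR <> 0 ->
     weak_focus_at_infinity fL fR 1 /\
     (yR - yL > 0 -> stable_at_infinity fL fR) /\
     (yR - yL < 0 -> unstable_at_infinity fL fR)) /\
  (gL <> 0 -> yL = yR -> aL ^ 2 - aR ^ 2 <> 0 ->
     weak_focus_at_infinity fL fR 2 /\
     (gL * (aL ^ 2 - aR ^ 2) > 0 -> stable_at_infinity fL fR) /\
     (gL * (aL ^ 2 - aR ^ 2) < 0 -> unstable_at_infinity fL fR)) /\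
  (gL <> 0 -> yL = 0 -> yR = 0 -> aL = aR -> aL <> 0 ->
     weak_focus_at_infinity fL fR 3 /\
     (gL * aL < 0 -> stable_at_infinity fL fR) /\
     (gL * aL > 0 -> unstable_at_infinity fL fR)).
Proof.
  intros fL fR yL yR Hg.
  destruct (displacement_expansion gL gR aL aR b)
    as [_ [mL [mR [eps [HL0 [HR0 [HL [HR [Heps Hs]]]]]]]]].
  fold fL fR in Hs.
  apply half_return_coefficients in HL. apply half_return_coefficients in HR.
  destruct HL as [HL1 [HL2 HL3]]. destruct HR as [HR1 [HR2 HR3]].
  rewrite HL0 in HL1, HL2, HL3. rewrite HR0 in HR1, HR2, HR3.
  replace (gR * PI) with (- gL * PI) in * by (rewrite Hg; ring).
  set (l := - exp (- gL * PI)) in *.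
  assert (Hl : l < 0) by (unfold l; pose proof (exp_pos (- gL * PI)); lra).
  (* [l ^ 2] is exp (- 2 gL pi), so [1 - l ^ 2] has the sign of [gL]. *)
  assert (Hlg : gL <> 0 -> 0 < gL * (1 - l ^ 2)).
  { intros Hg0. pose proof PI_RGT_0.
    replace (l ^ 2) with (exp (- gL * PI) * exp (- gL * PI)) by (unfold l; ring).
    rewrite <- exp_plus.
    destruct (Rtotal_order gL 0) as [h|[h|h]]; [|easy|].
    - assert (exp 0 < exp (- gL * PI + - gL * PI)) by (apply exp_increasing; nra).
      rewrite exp_0 in *. nra.
    - assert (exp (- gL * PI + - gL * PI) < exp 0) by (apply exp_increasing; nra).
      rewrite exp_0 in *. nra. }
  set (c := fun n => shift mL n - shift mR n) in Hs.
  assert (Hc0 : c 0%nat = 0) by (unfold c; simpl; ring).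
  assert (Hc1 : c 1%nat = 0) by (unfold c; simpl; rewrite HL0, HR0; ring).
  assert (Hc2 : c 2%nat = l * (l - 1) * (yR - yL)).
  { unfold c; simpl. rewrite HL1, HR1. unfold yL, yR. ring. }
  assert (Hll : 0 < l * (l - 1)) by nra.
  split; [|split].
  - intros Hy.
    destruct (order_and_stability fL fR c eps 1 Heps Hs) as [H1 [H2 H3]].
    + intros [|[|i]] Hi; try easy; lia.
    + rewrite Hc2. apply Rmult_integral_contrapositive_currified; lra.
    + split; [|split; intros h; [apply H2|apply H3]; rewrite Hc2; nra].
      split; [lia|]. exists c. split; [easy|]. split.
      * intros [|[|i]] Hi; try easy; lia.
      * rewrite Hc2. apply Rmult_integral_contrapositive_currified; lra.
  - intros Hg0 Hy Ha.
    assert (Hc2' : c 2%nat = 0) by (rewrite Hc2, Hy; ring).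
    assert (Hm1 : mL 1%nat = mR 1%nat).
    { rewrite HL1, HR1. unfold yL, yR in Hy. f_equal. lra. }
    assert (Hc3 : c 3%nat = / 2 * (- l * (1 + gL ^ 2)) * ((1 - l ^ 2) * (aL ^ 2 - aR ^ 2))).
    { unfold c; simpl. rewrite HL2, HR2, HL1, HR1.
      unfold yL, yR in Hy. subst gL. clear - Hy.
      assert (Hb : b = - gR * aL - gR * aR) by lra. rewrite Hb. field. }
    assert (Hpos : 0 < / 2 * (- l * (1 + gL ^ 2))).
    { apply Rmult_lt_0_compat; [lra|]. apply Rmult_lt_0_compat; [lra|]. nra. }
    assert (Hg1 := Hlg Hg0).
    assert (Hsq : 0 < gL ^ 2) by nra.
    assert (Hl2 : 1 - l ^ 2 <> 0) by nra.
    assert (Hne : c 3%nat <> 0).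
    { rewrite Hc3. apply Rmult_integral_contrapositive_currified; [lra|].
      now apply Rmult_integral_contrapositive_currified. }
    (* [1 - l ^ 2] is exchanged for [gL], of the same sign, at the cost of the positive factor
       [gL ^ 2]; [s = 1] gives stability and [s = -1] instability. *)
    assert (Hsgn : forall s, 0 < s * (gL * (aL ^ 2 - aR ^ 2)) -> 0 < s * c 3%nat).
    { intros s Hsg. rewrite Hc3.
      replace (s * (/ 2 * (- l * (1 + gL ^ 2)) * ((1 - l ^ 2) * (aL ^ 2 - aR ^ 2))))
        with ((/ 2 * (- l * (1 + gL ^ 2))) * (gL * (1 - l ^ 2))
              * (s * (gL * (aL ^ 2 - aR ^ 2))) * / (gL ^ 2)) by (field; lra).
      apply Rmult_lt_0_compat; [|now apply Rinv_0_lt_compat].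
      apply Rmult_lt_0_compat; [|easy]. now apply Rmult_lt_0_compat. }
    assert (Hz : forall i, (i <= 2)%nat -> c i = 0).
    { intros [|[|[|i]]] Hi; try easy; lia. }
    destruct (order_and_stability fL fR c eps 2 Heps Hs Hz Hne) as [H1 [H2 H3]].
    split; [|split].
    + split; [lia|]. now exists c.
    + intros h. apply H2. pose proof (Hsgn 1). lra.
    + intros h. apply H3. pose proof (Hsgn (-1)). lra.
  - intros Hg0 HyL HyR Ha Ha0.
    assert (Hc2' : c 2%nat = 0) by (rewrite Hc2, HyL, HyR; ring).
    assert (Hb : b = 2 * gL * aL) by (unfold yL in HyL; lra).
    (* The coefficients [mL 3] and [mR 3] are opposite: [l] and [q = aL ^ 2 * (1 + gL ^ 2)] are
       common to both sides, while the reflection changes the sign of [b]. Their difference doubles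
       instead of cancelling. *)
    assert (Hc4 : c 4%nat =
      - 4 / 3 * (gL * aL) * (aL ^ 2 * (1 + gL ^ 2)) * (l * (l ^ 3 - 1))).
    { unfold c; simpl.
      rewrite HL3 by lra. rewrite HR3 by (subst gL aR; lra).
      replace gR with (- gL) by lra. rewrite <- Ha, Hb. field. }
    assert (Hc3 : c 3%nat = 0).
    { unfold c; simpl. rewrite HL2, HR2, HL1, HR1.
      replace gR with (- gL) by lra. rewrite <- Ha, Hb. field. }
    assert (Hz : forall i, (i <= 3)%nat -> c i = 0).
    { intros [|[|[|[|i]]]] Hi; try easy; lia. }
    assert (Hl3 : 0 < l * (l ^ 3 - 1)) by nra.
    assert (Hq : 0 < aL ^ 2 * (1 + gL ^ 2)).
    { apply Rmult_lt_0_compat; nra. }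
    assert (HQ : 0 < (aL ^ 2 * (1 + gL ^ 2)) * (l * (l ^ 3 - 1))) by nra.
    set (Q := (aL ^ 2 * (1 + gL ^ 2)) * (l * (l ^ 3 - 1))) in *.
    assert (Hc4' : c 4%nat = - 4 / 3 * (gL * aL) * Q) by (rewrite Hc4; unfold Q; ring).
    assert (Hne : c 4%nat <> 0).
    { rewrite Hc4'.
      apply Rmult_integral_contrapositive_currified; [|apply Rgt_not_eq; exact HQ].
      apply Rmult_integral_contrapositive_currified; [lra|].
      now apply Rmult_integral_contrapositive_currified. }
    destruct (order_and_stability fL fR c eps 3 Heps Hs Hz Hne) as [H1 [H2 H3]].
    split; [|split].
    + split; [lia|]. now exists c.
    + intros h. apply H2. rewrite Hc4'. nra.
    + intros h. apply H3. rewrite Hc4'. nra.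
Qed.

(** * Trajectories near infinity when [b = 0] *)

(** For [b = 0] the left and right fields have the same form, so one notation serves both
    half-planes. *)
Definition lin0 (g a : R) : R * R -> R * R := lin g a 0.

(** Arbitrary end points, instead of 0 as in [trajectory], make the notion stable under time shift
    and reversal. *)
Definition is_primitive (v z : R -> R) : Prop :=
  forall s t, is_RInt v s t (z t - z s).

Lemma is_primitive_of_0 (v z : R -> R) :
  (forall t, is_RInt v 0 t (z t - z 0)) -> is_primitive v z.
Proof.
  intros H s t.
  replace (z t - z s) with (plus (opp (z s - z 0)) (z t - z 0)).
  - apply (is_RInt_Chasles v s 0 t); [|apply H]. exact (is_RInt_swap v _ _ _ (H s)).
  - unfold plus, opp; simpl. ring.
Qed.

Lemma primitive_shift (v z : R -> R) (c : R) :
  is_primitive v z -> is_primitive (fun t => v (t + c)) (fun t => z (t + c)).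
Proof.
  intros H s t.
  apply is_RInt_ext with (fun y => scal 1 (v (1 * y + c))).
  - intros x _. unfold scal; simpl; unfold mult; simpl. rewrite !Rmult_1_l. easy.
  - apply (is_RInt_comp_lin v 1 c s t (z (t + c) - z (s + c))). rewrite !Rmult_1_l. apply H.
Qed.

Lemma primitive_reverse (v z : R -> R) :
  is_primitive v z -> is_primitive (fun t => - v (- t)) (fun t => z (- t)).
Proof.
  intros H s t.
  apply is_RInt_ext with (fun y => opp (v (- y))); [easy|].
  exact (is_RInt_comp_opp v s t _ (H (- s) (- t))).
Qed.

Lemma primitive_opp (v z : R -> R) :
  is_primitive v z -> is_primitive (fun t => - v t) (fun t => - z t).
Proof.
  intros H s t. replace (- z t - - z s) with (opp (z t - z s)).
  - apply (is_RInt_opp v s t), H.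
  - unfold opp; simpl. ring.
Qed.

Lemma primitive_continuous (v z : R -> R) (t : R) :
  is_primitive v z -> continuous z t.
Proof.
  intros H.
  apply continuous_ext with (fun s => plus (z s - z t) (z t)).
  - intros s. unfold plus; simpl. ring.
  - apply (continuous_plus (fun s => z s - z t) (fun _ => z t));
      [|apply continuous_const].
    apply (continuous_RInt_1 v t t (fun s => z s - z t)).
    exists (mkposreal 1 Rlt_0_1). intros s _. apply H.
Qed.

Lemma primitive_derive (v z w : R -> R) (t : R) :
  is_primitive v z -> locally t (fun s => v s = w s) -> continuous w t ->
  is_derive z t (w t).
Proof.
  intros H Hvw Hw.
  rewrite <- (locally_singleton _ _ Hvw).
  apply (is_derive_ext (fun s => plus (z s - z t) (z t)) z).
  { intros s. unfold plus; simpl. ring. }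
  replace (v t) with (plus (v t) zero) by apply plus_zero_r.
  apply (is_derive_plus (fun s => z s - z t) (fun _ => z t)).
  - apply (is_derive_RInt v (fun s => z s - z t) t t).
    + exists (mkposreal 1 Rlt_0_1). intros s _. apply H.
    + apply continuous_ext_loc with w; [|easy].
      apply filter_imp with (2 := Hvw). intros s Hs. now rewrite Hs.
  - exact (is_derive_const (z t) t).
Qed.

Definition traj_with (gL aL gR aR : R) (z v : R -> R * R) : Prop :=
  (forall t, filippov (lin0 gL aL) (lin0 gR aR) (z t) (v t)) /\
  is_primitive (fun s => fst (v s)) (fun s => fst (z s)) /\
  is_primitive (fun s => snd (v s)) (fun s => snd (z s)).

Definition traj (gL aL gR aR : R) (z : R -> R * R) : Prop :=
  exists v, traj_with gL aL gR aR z v.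

Lemma trajectory_traj (gL aL gR aR : R) (z : R -> R * R) :
  trajectory (lin0 gL aL) (lin0 gR aR) z <-> traj gL aL gR aR z.
Proof.
  split; intros [v Hv]; exists v.
  - split; [|split].
    + intros t. apply Hv.
    + apply (is_primitive_of_0 (fun s => fst (v s)) (fun s => fst (z s))).
      intros t. apply Hv.
    + apply (is_primitive_of_0 (fun s => snd (v s)) (fun s => snd (z s))).
      intros t. apply Hv.
  - intros t. destruct Hv as [H1 [H2 H3]]. split; [apply H1|].
    split; [apply H2|apply H3].
Qed.

Lemma traj_shift (gL aL gR aR c : R) (z : R -> R * R) :
  traj gL aL gR aR z -> traj gL aL gR aR (fun t => z (t + c)).
Proof.
  intros [v [H1 [H2 H3]]]. exists (fun t => v (t + c)). split; [|split].
  - intros t. apply H1.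
  - exact (primitive_shift _ _ c H2).
  - exact (primitive_shift _ _ c H3).
Qed.

Lemma lin0_reflect (g a : R) (p : R * R) :
  lin0 (- g) (- a) (- fst p, snd p) = (fst (lin0 g a p), - snd (lin0 g a p)).
Proof. unfold lin0, lin, left_field; simpl. f_equal; ring. Qed.

(** Reflection exchanges the two half-planes and the direction of time, so a weight [l] in the
    convex combination becomes [1 - l]. It transfers forward statements to backward ones, and
    statements on the right half-plane to the left one. *)
Lemma traj_refl (gL aL gR aR : R) (z : R -> R * R) :
  traj gL aL gR aR z -> traj (- gR) (- aR) (- gL) (- aL) (refl z).
Proof.
  intros [v [H1 [H2 H3]]].
  exists (fun t => (fst (v (- t)), - snd (v (- t)))). split; [|split].
  - intros t. destruct (H1 (- t)) as [HL [HR H0]]. unfold refl.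
    split; [|split]; simpl fst; simpl snd; rewrite ?lin0_reflect; intros Hx.
    + rewrite HR by lra. easy.
    + rewrite HL by lra. easy.
    + destruct H0 as [l [Hl [E1 E2]]]; [lra|].
      exists (1 - l). split; [lra|]. rewrite E1, E2; simpl. split; ring.
  - apply primitive_reverse in H2. apply primitive_opp in H2.
    intros s t. eapply is_RInt_ext; [|apply H2].
    intros x _; simpl. ring.
  - apply primitive_reverse in H3. exact H3.
Qed.

Lemma traj_continuous (gL aL gR aR t : R) (z : R -> R * R) :
  traj gL aL gR aR z -> continuous_at z t.
Proof.
  intros [v [_ [H2 H3]]]. split; eapply primitive_continuous; eassumption.
Qed.

Lemma lin_continuous (g a b t : R) (z : R -> R * R) :
  continuous_at z t ->
  continuous (fun s => fst (lin g a b (z s))) t /\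
  continuous (fun s => snd (lin g a b (z s))) t.
Proof.
  intros [H1 H2]. unfold lin, left_field; simpl. split.
  - apply (continuous_minus (fun s => 2 * g * fst (z s) - snd (z s)) (fun _ => b));
      [|apply continuous_const].
    apply (continuous_minus (fun s => 2 * g * fst (z s)) (fun s => snd (z s))); [|easy].
    apply (continuous_mult (fun _ => 2 * g) (fun s => fst (z s))); [|easy].
    apply continuous_const.
  - eapply (continuous_minus (fun s => _ * fst (z s)) (fun _ => _));
      [|apply continuous_const].
    apply (continuous_mult (fun _ => _) (fun s => fst (z s))); [|easy].
    apply continuous_const.
Qed.

Lemma near_pos (f : R -> R) (t : R) :
  continuous f t -> 0 < f t -> locally t (fun s => 0 < f s).
Proof.
  intros Hf Hpos. apply (Hf (fun y => 0 < y)).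
  exists (mkposreal _ Hpos). intros y Hy.
  unfold ball in Hy; simpl in Hy.
  unfold AbsRing_ball, abs, minus, plus, opp in Hy; simpl in Hy.
  apply Rabs_def2 in Hy. lra.
Qed.

(* [sg = -1] for the left half-plane, [sg = 1] for the right one. *)
Definition on_side (gL aL gR aR sg g a : R) : Prop :=
  (sg = -1 /\ g = gL /\ a = aL) \/ (sg = 1 /\ g = gR /\ a = aR).

Lemma traj_side_near (gL aL gR aR sg g a t : R) (z : R -> R * R) :
  on_side gL aL gR aR sg g a -> traj gL aL gR aR z ->
  0 < sg * fst (z t) -> locally t (fun s => 0 < sg * fst (z s)).
Proof.
  intros Hside Hz Hpos. apply near_pos; [|easy].
  apply (continuous_mult (fun _ => sg) (fun s => fst (z s)));
    [apply continuous_const|]. exact (proj1 (traj_continuous _ _ _ _ t _ Hz)).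
Qed.

Lemma traj_side_solves (gL aL gR aR sg g a t : R) (z : R -> R * R) :
  on_side gL aL gR aR sg g a -> traj gL aL gR aR z ->
  0 < sg * fst (z t) -> solves_at (lin0 g a) z t.
Proof.
  intros Hside Hz Hpos.
  assert (Hnear := traj_side_near _ _ _ _ _ _ _ _ _ Hside Hz Hpos).
  destruct (lin_continuous g a 0 t z (traj_continuous _ _ _ _ t _ Hz)) as [Hc1 Hc2].
  destruct Hz as [v [Hf [H1 H2]]].
  assert (Hv : forall s, 0 < sg * fst (z s) -> v s = lin0 g a (z s)).
  { intros s Hs. destruct (Hf s) as [HL [HR _]].
    destruct Hside as [[-> [-> ->]]|[-> [-> ->]]].
    - apply HL. lra.
    - apply HR. lra. }
  split.
  - apply (primitive_derive (fun s => fst (v s)) (fun s => fst (z s))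
      (fun s => fst (lin0 g a (z s)))); [easy| |easy].
    apply filter_imp with (2 := Hnear). intros s Hs. now rewrite Hv.
  - apply (primitive_derive (fun s => snd (v s)) (fun s => snd (z s))
      (fun s => snd (lin0 g a (z s)))); [easy| |easy].
    apply filter_imp with (2 := Hnear). intros s Hs. now rewrite Hv.
Qed.

(* For [b = 0] both fields have the same horizontal component on [x = 0]. *)
Lemma traj_crossing (gL aL gR aR t y : R) (z : R -> R * R) :
  traj gL aL gR aR z -> z t = (0, y) -> is_derive (fun s => fst (z s)) t (- y).
Proof.
  intros Hz Hzt.
  destruct (traj_continuous _ _ _ _ t _ Hz) as [Hc1 Hc2].
  destruct Hz as [v [Hf [H1 H2]]].
  (* One formula for the horizontal velocity on both sides and on the line, whatever convex
     combination is selected; being continuous in [s], it is a genuine derivative. *)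
  set (w := fun s => 2 * (gL * Rmin (fst (z s)) 0 + gR * Rmax (fst (z s)) 0) - snd (z s)).
  assert (Hw : forall s, fst (v s) = w s).
  { intros s. unfold w. destruct (Hf s) as [HL [HR H0]].
    destruct (Rtotal_order (fst (z s)) 0) as [h|[h|h]].
    - rewrite HL, Rmin_left, Rmax_right by lra.
      unfold lin0, lin, left_field; simpl. ring.
    - destruct (H0 h) as [l [_ [E _]]]. rewrite E, h, Rmin_left, Rmax_right by lra.
      unfold lin0, lin, left_field; simpl. rewrite h. ring.
    - rewrite HR, Rmin_right, Rmax_left by lra.
      unfold lin0, lin, left_field; simpl. ring. }
  assert (Hwt : w t = - y).
  { unfold w. rewrite Hzt; simpl. rewrite Rmin_left, Rmax_right by lra. ring. }
  rewrite <- Hwt.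
  apply (primitive_derive (fun s => fst (v s)) (fun s => fst (z s)) w); [easy| |].
  - apply filter_forall. exact Hw.
  - assert (Habs : continuous (fun s => Rabs (fst (z s))) t).
    { apply (continuous_comp (fun s => fst (z s)) Rabs); [easy|apply continuous_Rabs]. }
    apply continuous_ext with (fun s =>
      minus (plus (mult (gL + gR) (fst (z s))) (mult (gR - gL) (Rabs (fst (z s)))))
            (snd (z s))).
    { intros s. unfold w, minus, plus, mult, opp; simpl.
      unfold Rmin, Rmax, Rabs.
      destruct (Rle_dec (fst (z s)) 0), (Rcase_abs (fst (z s))); try lra.
      replace (fst (z s)) with 0 by lra. ring. }
    apply (continuous_minus
      (fun s => plus (mult (gL + gR) (fst (z s))) (mult (gR - gL) (Rabs (fst (z s)))))
      (fun s => snd (z s))); [|easy].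
    apply (continuous_plus (fun s => mult (gL + gR) (fst (z s)))
      (fun s => mult (gR - gL) (Rabs (fst (z s))))).
    + apply (continuous_mult (fun _ => gL + gR) (fun s => fst (z s)));
        [apply continuous_const|easy].
    + apply (continuous_mult (fun _ => gR - gL) (fun s => Rabs (fst (z s))));
        [apply continuous_const|easy].
Qed.

(** Let [S] be the supremum of the times up to which [z] stays strictly on the side. By uniqueness
    [z = w] on [0, S]; if [S < T], then [w] is strictly inside at [S], hence so is [z], and the stay
    extends beyond [S]. *)
Lemma traj_follows_flow (gL aL gR aR sg g a T : R) (z w : R -> R * R) :
  on_side gL aL gR aR sg g a -> traj gL aL gR aR z -> solves (lin0 g a) w ->
  z 0 = w 0 ->
  (exists d, 0 < d /\ forall t, 0 < t < d -> 0 < sg * fst (z t)) ->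
  (forall t, 0 < t < T -> 0 < sg * fst (w t)) ->
  forall t, 0 <= t <= T -> z t = w t.
Proof.
  intros Hside Hz Hw H0 [d [Hd Hentry]] Hwpos.
  assert (Heq : forall S, 0 <= S -> (forall t, 0 < t < S -> 0 < sg * fst (z t)) ->
    forall t, 0 <= t <= S -> z t = w t).
  { intros S HS Hpos t Ht.
    apply (lin_unique g a 0 z w 0 t); [lra| | |easy].
    - intros v Hv. split; [|apply Hw].
      apply (traj_side_solves gL aL gR aR sg); try easy. apply Hpos. lra.
    - intros v Hv. split; [now apply (traj_continuous gL aL gR aR)|].
      eapply solves_at_continuous. apply Hw. }
  intros t Ht.
  assert (HT : 0 <= T) by lra.
  apply (Heq T HT); [|easy]. clear t Ht. intros t Ht.
  destruct (Rlt_le_dec 0 (sg * fst (z t))) as [h|h]; [easy|exfalso].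
  set (E := fun s => 0 <= s <= t /\ forall v, 0 < v < s -> 0 < sg * fst (z v)).
  destruct (completeness E) as [S [HS1 HS2]].
  - exists t. intros s [Hs _]. lra.
  - exists 0. split; [lra|]. intros v Hv. lra.
  - assert (HSt : S <= t) by (apply HS2; intros s [Hs _]; lra).
    assert (Hdt : d <= t).
    { destruct (Rlt_le_dec t d) as [h'|h']; [|easy].
      specialize (Hentry t ltac:(lra)). lra. }
    assert (HdS : d <= S).
    { apply HS1. split; [lra|]. intros v Hv. apply Hentry. lra. }
    assert (HposS : forall v, 0 < v < S -> 0 < sg * fst (z v)).
    { intros v Hv. destruct (Rlt_le_dec 0 (sg * fst (z v))) as [h'|h']; [easy|exfalso].
      assert (S <= v); [|lra].
      apply HS2. intros s [Hs1 Hs2].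
      destruct (Rle_lt_dec s v) as [h''|h'']; [easy|].
      specialize (Hs2 v ltac:(lra)). lra. }
    assert (HzS : 0 < sg * fst (z S)).
    { rewrite (Heq S ltac:(lra) HposS S) by lra. apply Hwpos. lra. }
    assert (Hlt : S < t).
    { destruct (Req_dec S t) as [->|h']; lra. }
    destruct (traj_side_near _ _ _ _ _ _ _ _ _ Hside Hz HzS) as [e He].
    assert (He0 := cond_pos e).
    set (s := Rmin (S + e / 2) t).
    assert (Hs : S < s /\ s <= S + e / 2 /\ s <= t).
    { unfold s. split; [apply Rmin_glb_lt; lra|]. split; [apply Rmin_l|apply Rmin_r]. }
    assert (s <= S); [|lra].
    apply HS1. split; [lra|]. intros v Hv.
    destruct (Rlt_le_dec v S) as [h'|h']; [apply HposS; lra|].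
    apply He. unfold ball; simpl. unfold AbsRing_ball, abs, minus, plus, opp; simpl.
    rewrite Rabs_pos_eq; lra.
Qed.

Lemma traj_enters (gL aL gR aR sg g a y : R) (z : R -> R * R) :
  on_side gL aL gR aR sg g a -> traj gL aL gR aR z ->
  0 < sg * fst (z 0) \/ (z 0 = (0, y) /\ sg * y < 0) ->
  exists d, 0 < d /\ forall t, 0 < t < d -> 0 < sg * fst (z t).
Proof.
  intros Hside Hz [Hpos|[H0 Hy]].
  - destruct (traj_side_near _ _ _ _ _ _ _ _ _ Hside Hz Hpos) as [e He].
    exists e. split; [apply cond_pos|]. intros t Ht.
    apply He. unfold ball; simpl. unfold AbsRing_ball, abs, minus, plus, opp; simpl.
    rewrite Rabs_pos_eq; lra.
  - assert (Hd : is_derive (fun s => sg * fst (z s)) 0 (sg * - y)).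
    { apply (is_derive_scal (fun s => fst (z s)) 0 sg).
      apply (traj_crossing gL aL gR aR); easy. }
    destruct (derive_pos_right _ _ _ Hd) as [d [Hd0 Hd1]]; [lra|].
    exists d. split; [easy|]. intros t Ht.
    specialize (Hd1 t ltac:(lra)). rewrite H0 in Hd1. simpl in Hd1. lra.
Qed.

Lemma lin0_refl_solves (g a : R) (z : R -> R * R) :
  solves (lin0 g a) z -> solves (lin0 (- g) (- a)) (refl z).
Proof.
  intros H t. destruct (H (- t)) as [H1 H2].
  change (is_derive (fun s => - fst (z (- s))) t
            (fst (lin0 (- g) (- a) (- fst (z (- t)), snd (z (- t))))) /\
          is_derive (fun s => snd (z (- s))) t
            (snd (lin0 (- g) (- a) (- fst (z (- t)), snd (z (- t)))))).
  rewrite lin0_reflect. split.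
  - apply is_derive_reverse in H1.
    apply (is_derive_opp (fun s => fst (z (- s)))) in H1.
    apply (is_derive_eq _ _ _ _ H1). unfold opp; simpl. ring.
  - exact (is_derive_reverse (fun s => snd (z s)) t _ H2).
Qed.

(** * Closed orbits made of a left and a right arc *)

Record cycle (gL aL gR aR y0 y1 TL TR : R) (zL zR : R -> R * R) : Prop := {
  cycle_top : 0 < y0;
  cycle_bottom : y1 < 0;
  cycle_left : left_arc (lin0 gL aL) y0 y1 TL zL;
  cycle_right_solves : solves (lin0 gR aR) zR;
  cycle_right_time : 0 < TR < 2 * PI;
  cycle_right_0 : zR 0 = (0, y1);
  cycle_right_T : zR TR = (0, y0);
  cycle_right_pos : forall t, 0 < t < TR -> 0 < fst (zR t) }.

(** The reflected arc, with time shifted so that it starts from the reflected end point of [z] at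
    time 0; it turns right arcs into left arcs and conversely. *)
Definition reversed (z : R -> R * R) (T t : R) : R * R := refl z (t + - T).

Lemma reversed_eq (z : R -> R * R) (T t : R) :
  reversed z T t = (- fst (z (T - t)), snd (z (T - t))).
Proof. unfold reversed, refl. now replace (- (t + - T)) with (T - t) by ring. Qed.

Lemma reversed_solves (g a T : R) (z : R -> R * R) :
  solves (lin0 g a) z -> solves (lin0 (- g) (- a)) (reversed z T).
Proof.
  intros H. apply (solves_shift (- g) (- a) 0 (refl z) (- T)).
  now apply lin0_refl_solves.
Qed.

Lemma cycle_reversed (gL aL gR aR y0 y1 TL TR : R) (zL zR : R -> R * R) :
  cycle gL aL gR aR y0 y1 TL TR zL zR ->
  cycle (- gR) (- aR) (- gL) (- aL) y0 y1 TR TL (reversed zR TR) (reversed zL TL).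
Proof.
  intros [H0 H1 [HL1 [HL2 [HL3 [HL4 HL5]]]] HR1 HR2 HR3 HR4 HR5].
  split; try easy.
  - split; [now apply reversed_solves|]. split; [easy|].
    rewrite !reversed_eq, Rminus_0_r, Rminus_diag, HR3, HR4; cbn [fst snd].
    rewrite Ropp_0. split; [easy|]. split; [easy|].
    intros t Ht. rewrite reversed_eq; cbn [fst snd]. specialize (HR5 (TR - t) ltac:(lra)). lra.
  - now apply reversed_solves.
  - rewrite reversed_eq, Rminus_0_r, HL4; cbn [fst snd]. now rewrite Ropp_0.
  - rewrite reversed_eq, Rminus_diag, HL3; cbn [fst snd]. now rewrite Ropp_0.
  - intros t Ht. rewrite reversed_eq; cbn [fst snd]. specialize (HL5 (TL - t) ltac:(lra)). lra.
Qed.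

Lemma traj_follows_cycle (gL aL gR aR y0 y1 TL TR : R) (zL zR z : R -> R * R) :
  cycle gL aL gR aR y0 y1 TL TR zL zR -> traj gL aL gR aR z -> z 0 = (0, y0) ->
  (forall t, 0 <= t <= TL -> z t = zL t) /\
  (forall t, 0 <= t <= TR -> z (t + TL) = zR t).
Proof.
  intros [H0 H1 [HL1 [HL2 [HL3 [HL4 HL5]]]] HR1 HR2 HR3 HR4 HR5] Hz Hz0.
  assert (HsL : on_side gL aL gR aR (-1) gL aL) by now left.
  assert (HsR : on_side gL aL gR aR 1 gR aR) by now right.
  assert (HfL : forall t, 0 <= t <= TL -> z t = zL t).
  { apply (traj_follows_flow gL aL gR aR (-1) gL aL); try easy.
    - now rewrite Hz0, HL3.
    - apply (traj_enters gL aL gR aR (-1) gL aL y0); try easy. right. split; [easy|lra].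
    - intros t Ht. specialize (HL5 t Ht). lra. }
  split; [easy|].
  assert (Hz1 : z (0 + TL) = (0, y1)) by (rewrite Rplus_0_l, HfL, HL4; [easy|lra]).
  apply (traj_follows_flow gL aL gR aR 1 gR aR TR (fun t => z (t + TL)) zR); try easy.
  - now apply traj_shift.
  - now rewrite Hz1, HR3.
  - apply (traj_enters gL aL gR aR 1 gR aR y1); try easy.
    + now apply traj_shift.
    + right. split; [easy|lra].
  - intros t Ht. specialize (HR5 t Ht). lra.
Qed.

Lemma traj_cycle_return (gL aL gR aR y0 y1 TL TR : R) (zL zR z : R -> R * R) :
  cycle gL aL gR aR y0 y1 TL TR zL zR -> traj gL aL gR aR z -> z 0 = (0, y0) ->
  z (TL + TR) = (0, y0) /\ z (- (TL + TR)) = (0, y0).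
Proof.
  intros Hc Hz Hz0.
  assert (Hfwd : forall gL aL gR aR TL TR zL zR z,
    cycle gL aL gR aR y0 y1 TL TR zL zR -> traj gL aL gR aR z -> z 0 = (0, y0) ->
    z (TL + TR) = (0, y0)).
  { clear. intros gL aL gR aR TL TR zL zR z Hc Hz Hz0.
    destruct (traj_follows_cycle _ _ _ _ _ _ _ _ _ _ _ Hc Hz Hz0) as [_ H].
    destruct Hc as [_ _ _ _ HR2 _ HR4 _].
    rewrite Rplus_comm, H; [easy|lra]. }
  split; [now apply (Hfwd _ _ _ _ _ _ _ _ _ Hc Hz Hz0)|].
  (* The backward return is the forward return of the reflected trajectory along the reflected
     cycle. *)
  apply cycle_reversed in Hc. apply traj_refl in Hz.
  assert (H := Hfwd _ _ _ _ _ _ _ _ _ Hc Hz).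
  unfold refl in H. rewrite Ropp_0, Hz0 in H; simpl in H. rewrite Ropp_0 in H.
  specialize (H eq_refl). rewrite (Rplus_comm TR) in H.
  destruct (z (- (TL + TR))) as [x y]; simpl in H. inversion H.
  f_equal. lra.
Qed.

Lemma archimedean_multiple (T x : R) : 0 < T -> exists n : nat, x <= INR n * T.
Proof.
  intros HT. destruct (INR_unbounded (x / T)) as [n Hn].
  exists n. replace x with (x / T * T) by (field; lra).
  apply Rmult_le_compat_r; lra.
Qed.

(** The point [w] is chosen before [z]: besides confinement to the cycle, this is forward
    uniqueness, which lets a trajectory be compared with its own shift. *)
Lemma traj_cycle_range (gL aL gR aR y0 y1 TL TR : R) (zL zR : R -> R * R) :
  cycle gL aL gR aR y0 y1 TL TR zL zR ->
  forall t, 0 <= t -> exists w : R * R,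
    ((exists s, 0 <= s <= TL /\ w = zL s) \/ (exists s, 0 <= s <= TR /\ w = zR s)) /\
    forall z, traj gL aL gR aR z -> z 0 = (0, y0) -> z t = w.
Proof.
  intros Hc t Ht.
  assert (HTL : 0 < TL) by (destruct Hc as [_ _ [_ [HTL _]] _ _ _ _ _]; lra).
  assert (HTR : 0 < TR) by (destruct Hc as [_ _ _ _ HTR _ _ _]; lra).
  destruct (archimedean_multiple (TL + TR) t ltac:(lra)) as [n Hn].
  revert t Ht Hn. induction n as [|n IH]; intros t Ht Hn.
  - simpl in Hn. exists (zL t). split.
    + left. exists t. split; [lra|easy].
    + intros z Hz Hz0.
      apply (traj_follows_cycle _ _ _ _ _ _ _ _ _ _ _ Hc Hz Hz0). lra.
  - destruct (Rle_lt_dec t TL) as [h|h].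
    { exists (zL t). split; [left; exists t; split; [lra|easy]|].
      intros z Hz Hz0.
      apply (traj_follows_cycle _ _ _ _ _ _ _ _ _ _ _ Hc Hz Hz0). lra. }
    destruct (Rle_lt_dec t (TL + TR)) as [h'|h'].
    { exists (zR (t - TL)). split; [right; exists (t - TL); split; [lra|easy]|].
      intros z Hz Hz0.
      destruct (traj_follows_cycle _ _ _ _ _ _ _ _ _ _ _ Hc Hz Hz0) as [_ H].
      rewrite <- H by lra. f_equal. ring. }
    rewrite S_INR in Hn.
    destruct (IH (t - (TL + TR)) ltac:(lra) ltac:(lra)) as [w [Hw1 Hw2]].
    exists w. split; [easy|]. intros z Hz Hz0.
    rewrite <- (Hw2 (fun s => z (s + (TL + TR)))).
    + f_equal. ring.
    + now apply traj_shift.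
    + rewrite Rplus_0_l. now apply (traj_cycle_return _ _ _ _ _ _ _ _ _ _ _ Hc Hz).
Qed.

(** For [t >= 0], [z] and its shift by one period start from the same point, and forward uniqueness
    applies. Negative times are reached by moving the origin of time back one period at a time. *)
Lemma traj_cycle_period (gL aL gR aR y0 y1 TL TR : R) (zL zR z : R -> R * R) :
  cycle gL aL gR aR y0 y1 TL TR zL zR -> traj gL aL gR aR z -> z 0 = (0, y0) ->
  forall t, z (t + (TL + TR)) = z t.
Proof.
  intros Hc Hz Hz0 t.
  assert (HTL : 0 < TL) by (destruct Hc as [_ _ [_ [HTL _]] _ _ _ _ _]; lra).
  assert (HTR : 0 < TR) by (destruct Hc as [_ _ _ _ HTR _ _ _]; lra).
  assert (Hn : exists n, - t <= INR n * (TL + TR)) by (apply archimedean_multiple; lra).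
  destruct Hn as [n Hn]. revert z Hz Hz0 t Hn.
  induction n as [|n IH]; intros z Hz Hz0 t Hn.
  - simpl in Hn.
    destruct (traj_cycle_range _ _ _ _ _ _ _ _ _ _ Hc t ltac:(lra)) as [w [_ Hw]].
    rewrite (Hw z Hz Hz0). apply (Hw (fun s => z (s + (TL + TR)))).
    + now apply traj_shift.
    + rewrite Rplus_0_l. now apply (traj_cycle_return _ _ _ _ _ _ _ _ _ _ _ Hc Hz).
  - rewrite S_INR in Hn.
    assert (H := IH (fun s => z (s + - (TL + TR)))).
    specialize (H (traj_shift _ _ _ _ _ _ Hz)).
    cbv beta in H. rewrite Rplus_0_l in H.
    specialize (H (proj2 (traj_cycle_return _ _ _ _ _ _ _ _ _ _ _ Hc Hz Hz0))).
    specialize (H (t + (TL + TR)) ltac:(lra)). simpl in H.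
    replace (t + (TL + TR) + - (TL + TR)) with t in H by ring.
    rewrite <- H. f_equal. ring.
Qed.

Lemma traj_cycle_everywhere (gL aL gR aR y0 y1 TL TR : R) (zL zR z : R -> R * R) :
  cycle gL aL gR aR y0 y1 TL TR zL zR -> traj gL aL gR aR z -> z 0 = (0, y0) ->
  forall t, (exists s, 0 <= s <= TL /\ z t = zL s) \/
            (exists s, 0 <= s <= TR /\ z t = zR s).
Proof.
  intros Hc Hz Hz0 t.
  assert (HTL : 0 < TL) by (destruct Hc as [_ _ [_ [HTL _]] _ _ _ _ _]; lra).
  assert (HTR : 0 < TR) by (destruct Hc as [_ _ _ _ HTR _ _ _]; lra).
  assert (Hper : forall n s, z (s + INR n * (TL + TR)) = z s).
  { induction n as [|n IH]; intros s.
    - simpl. f_equal. ring.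
    - rewrite S_INR. rewrite <- (IH s).
      rewrite <- (traj_cycle_period _ _ _ _ _ _ _ _ _ _ _ Hc Hz Hz0 (s + INR n * _)).
      f_equal. ring. }
  destruct (archimedean_multiple (TL + TR) (- t) ltac:(lra)) as [n Hn].
  destruct (traj_cycle_range _ _ _ _ _ _ _ _ _ _ Hc (t + INR n * (TL + TR)) ltac:(lra))
    as [w [Hw1 Hw2]].
  rewrite <- (Hper n t), (Hw2 z Hz Hz0). exact Hw1.
Qed.

Lemma cycle_traj_exists (gL aL gR aR y0 y1 TL TR : R) (zL zR : R -> R * R) :
  cycle gL aL gR aR y0 y1 TL TR zL zR ->
  exists z, traj gL aL gR aR z /\ z 0 = (0, y0).
Proof.
  intros [H0 H1 [HL1 [HL2 [HL3 [HL4 HL5]]]] HR1 HR2 HR3 HR4 HR5].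
  set (P := TL + TR).
  assert (HP : 0 < P) by (unfold P; lra).
  (* [r t] is [t] modulo the period; [W] runs through the left arc, then the right one, and [V] is
     the matching velocity. *)
  set (r := fun t => P * frac_part (t / P)).
  set (W := fun s => if Rle_dec s TL then zL s else zR (s - TL)).
  set (V := fun s => if Rle_dec s TL then lin0 gL aL (zL s) else lin0 gR aR (zR (s - TL))).
  assert (Hr : forall t, 0 <= r t < P).
  { intros t. unfold r. destruct (base_fp (t / P)). split.
    - apply Rmult_le_pos; lra.
    - assert (P * frac_part (t / P) < P * 1); [|lra].
      apply Rmult_lt_compat_l; lra. }
  assert (Hrn : forall t, exists n : Z, t = IZR n * P + r t).
  { intros t. exists (Int_part (t / P)). unfold r, frac_part. field. lra. }
  assert (Hru : forall (n : Z) s, 0 <= s < P -> r (IZR n * P + s) = s).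
  { intros n s Hs. destruct (Hrn (IZR n * P + s)) as [n' Hn'].
    assert (Hr' := Hr (IZR n * P + s)).
    assert (n = n'); [|subst; lra].
    assert (Hd : (IZR n - IZR n') * P = r (IZR n * P + s) - s) by lra.
    assert (-1 < IZR n - IZR n' < 1) by (split; nra).
    rewrite <- minus_IZR in H. destruct H as [Ha Hb].
    apply lt_IZR in Ha, Hb. lia. }
  exists (fun t => W (r t)).
  assert (HW0 : W 0 = (0, y0)).
  { unfold W. destruct (Rle_dec 0 TL); [easy|lra]. }
  assert (HWP : W P = (0, y0)).
  { unfold W. destruct (Rle_dec P TL); [unfold P in *; lra|].
    now replace (P - TL) with TR by (unfold P; ring). }
  assert (Hr0 : r 0 = 0).
  { rewrite <- (Hru 0%Z 0) at 2 by lra. f_equal. ring. }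
  split; [|now rewrite Hr0].
  exists (fun t => V (r t)).
  assert (Hfil : forall s, 0 <= s < P -> filippov (lin0 gL aL) (lin0 gR aR) (W s) (V s)).
  { intros s Hs. unfold W, V. destruct (Rle_dec s TL) as [h|h].
    - destruct (Req_dec s 0) as [->|h0]; [|destruct (Req_dec s TL) as [->|h1]].
      + rewrite HL3. repeat split; simpl; try lra. intros _. exists 1. repeat split; lra.
      + rewrite HL4. repeat split; simpl; try lra. intros _. exists 1. repeat split; lra.
      + specialize (HL5 s ltac:(lra)). repeat split; try easy; lra.
    - specialize (HR5 (s - TL)). unfold P in Hs. specialize (HR5 ltac:(lra)).
      repeat split; try easy; lra. }
  split; [intros t; apply Hfil, Hr|].
  assert (HRI : forall (pr : R * R -> R),
    (pr = fst \/ pr = snd) ->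
    is_primitive (fun s => pr (V (r s))) (fun s => pr (W (r s)))).
  { intros pr Hpr. apply is_primitive_of_0.
    assert (Hsol : forall g a z c, solves (lin0 g a) z -> forall s t,
      is_RInt (fun v => pr (lin0 g a (z (v + c)))) s t (pr (z (t + c)) - pr (z (s + c)))).
    { intros g a z c Hz s t.
      assert (Hz' := solves_shift g a 0 z c Hz).
      apply (is_RInt_derive (fun v => pr (z (v + c)))
        (fun v => pr (lin0 g a (z (v + c))))).
      - intros x _. destruct Hpr as [->| ->]; apply Hz'.
      - intros x _.
        destruct (lin_continuous g a 0 x (fun v => z (v + c))
          (solves_at_continuous _ _ _ (Hz' x))) as [Hc1 Hc2].
        destruct Hpr as [->| ->]; [exact Hc1|exact Hc2]. }
    assert (HV : forall s, 0 <= s <= P ->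
      is_RInt (fun v => pr (V v)) 0 s (pr (W s) - pr (W 0))).
    { assert (HVL : forall s, 0 <= s <= TL ->
        is_RInt (fun v => pr (V v)) 0 s (pr (zL s) - pr (zL 0))).
      { intros s Hs. apply is_RInt_ext with (fun v => pr (lin0 gL aL (zL (v + 0)))).
        - intros x. rewrite Rmin_left, Rmax_right by lra. intros Hx.
          rewrite Rplus_0_r. unfold V. destruct (Rle_dec x TL); [easy|lra].
        - pose proof (Hsol gL aL zL 0 HL1 0 s) as H.
          now rewrite !Rplus_0_r in H. }
      intros s Hs. rewrite HW0, <- HL3. unfold W.
      destruct (Rle_dec s TL) as [h|h]; [apply HVL; lra|].
      replace (pr (zR (s - TL)) - pr (zL 0)) with
        (plus (pr (zL TL) - pr (zL 0)) (pr (zR (s + - TL)) - pr (zR (TL + - TL)))).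
      2:{ unfold plus; simpl. rewrite Rplus_opp_r, HR3, HL4. unfold Rminus. ring. }
      apply (is_RInt_Chasles (fun v => pr (V v)) 0 TL s); [apply HVL; lra|].
      apply is_RInt_ext with (fun v => pr (lin0 gR aR (zR (v + - TL)))).
      - intros x. rewrite Rmin_left, Rmax_right by lra. intros Hx.
        unfold V. destruct (Rle_dec x TL); [lra|easy].
      - now apply Hsol. }
    assert (Hshift : forall (n : Z) s, 0 <= s <= P ->
      is_RInt (fun v => pr (V (r v))) (IZR n * P) (IZR n * P + s)
        (pr (W s) - pr (W 0))).
    { intros n s Hs.
      apply is_RInt_ext with (fun v => scal 1 (pr (V (1 * v + - (IZR n * P))))).
      - intros x. rewrite Rmin_left, Rmax_right by lra. intros Hx.
        unfold scal; simpl; unfold mult; simpl. rewrite !Rmult_1_l. do 2 f_equal.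
        rewrite <- (Hru n (x + - (IZR n * P))) by lra. f_equal. ring.
      - apply (is_RInt_comp_lin (fun v => pr (V v)) 1 (- (IZR n * P))).
        replace (1 * (IZR n * P) + - (IZR n * P)) with 0 by ring.
        replace (1 * (IZR n * P + s) + - (IZR n * P)) with s by ring.
        now apply HV. }
    (* The cycle closes up, [W P = W 0], so the velocity has integral 0 over each period; only the
       remainder [r t] contributes to the integral up to [t]. *)
    assert (Hperiod : forall n : Z,
      is_RInt (fun v => pr (V (r v))) (IZR n * P) (IZR (n + 1) * P) 0).
    { intros n. assert (H := Hshift n P ltac:(lra)).
      rewrite HWP, HW0, Rminus_diag in H.
      rewrite plus_IZR. replace ((IZR n + 1) * P) with (IZR n * P + P) by ring. easy. }
    assert (Hnat : forall n : nat,
      is_RInt (fun v => pr (V (r v))) 0 (IZR (Z.of_nat n) * P) 0 /\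
      is_RInt (fun v => pr (V (r v))) 0 (IZR (- Z.of_nat n) * P) 0).
    { induction n as [|n [IH1 IH2]].
      - simpl. rewrite Rmult_0_l.
        split; exact (is_RInt_point (fun v => pr (V (r v))) 0).
      - split.
        + rewrite <- (Rplus_0_r 0) at 2.
          apply (is_RInt_Chasles (fun v => pr (V (r v))) 0 (IZR (Z.of_nat n) * P));
            [easy|].
          rewrite Nat2Z.inj_succ. apply Hperiod.
        + rewrite <- (Rplus_0_r 0) at 2.
          apply (is_RInt_Chasles (fun v => pr (V (r v))) 0 (IZR (- Z.of_nat n) * P));
            [easy|].
          rewrite <- Ropp_0.
          apply (is_RInt_swap (fun v => pr (V (r v)))).
          replace (- Z.of_nat n)%Z with (- Z.of_nat (S n) + 1)%Z by lia.
          apply Hperiod. }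
    intros t. destruct (Hrn t) as [n Hn]. rewrite Hr0.
    rewrite Hn at 1.
    rewrite <- (Rplus_0_l (pr (W (r t)) - _)).
    apply (is_RInt_Chasles (fun v => pr (V (r v))) 0 (IZR n * P)).
    - destruct (Z_le_gt_dec 0 n) as [h|h].
      + replace n with (Z.of_nat (Z.to_nat n)) by lia. apply Hnat.
      + replace n with (- Z.of_nat (Z.to_nat (- n)))%Z by lia. apply Hnat.
    - apply Hshift. specialize (Hr t). lra. }
  split; apply HRI; auto.
Qed.

(** * Estimates on the linear flow far from the origin *)

Lemma abs_le_radius (p : R * R) : Rabs (fst p) <= radius p /\ Rabs (snd p) <= radius p.
Proof.
  unfold radius. rewrite <- (sqrt_Rsqr_abs (fst p)), <- (sqrt_Rsqr_abs (snd p)).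
  unfold Rsqr. split; apply sqrt_le_1_alt; nra.
Qed.

Lemma radius_le_abs (p : R * R) : radius p <= Rabs (fst p) + Rabs (snd p).
Proof.
  pose proof (Rabs_pos (fst p)). pose proof (Rabs_pos (snd p)).
  rewrite <- (sqrt_pow2 (Rabs (fst p) + Rabs (snd p))) by lra.
  unfold radius. apply sqrt_le_1_alt.
  rewrite <- (pow2_abs (fst p)), <- (pow2_abs (snd p)). nra.
Qed.

Definition size (g a : R) (p : R * R) : R :=
  Rabs (fst p - a) + Rabs (coordN g a 0 p).

Lemma radius_le_size (g a : R) (p : R * R) :
  radius p <= (1 + Rabs g) * size g a p + (Rabs a + 2 * Rabs (g * a)).
Proof.
  eapply Rle_trans; [apply radius_le_abs|]. unfold size.
  set (X := fst p - a). set (N := coordN g a 0 p).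
  replace (fst p) with (X + a) by (unfold X; ring).
  replace (snd p) with ((g * X + - N) + 2 * (g * a)) by (unfold N, X, coordN; ring).
  pose proof (Rabs_triang X a). pose proof (Rabs_triang (g * X + - N) (2 * (g * a))).
  pose proof (Rabs_triang (g * X) (- N)).
  rewrite Rabs_Ropp in *. rewrite Rabs_mult in H1.
  rewrite (Rabs_mult 2), (Rabs_pos_eq 2) in H0 by lra.
  pose proof (Rabs_pos g). pose proof (Rabs_pos N).
  assert (0 <= Rabs g * Rabs N) by now apply Rmult_le_pos. lra.
Qed.

Lemma size_le_radius (g a : R) (p : R * R) :
  size g a p <= (2 + Rabs g) * radius p + (Rabs a + 3 * Rabs (g * a)).
Proof.
  destruct (abs_le_radius p) as [Hx Hy]. unfold size, coordN.
  replace (g * (fst p - a) - (snd p - (2 * g * a - 0)))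
    with ((g * fst p + - snd p) + g * a) by ring.
  pose proof (Rabs_triang (fst p) (- a)). fold (fst p - a) in H.
  pose proof (Rabs_triang (g * fst p + - snd p) (g * a)).
  pose proof (Rabs_triang (g * fst p) (- snd p)).
  rewrite !Rabs_Ropp in *. rewrite (Rabs_mult g (fst p)) in H1.
  pose proof (Rabs_pos g). pose proof (Rabs_pos (g * a)).
  assert (Rabs g * Rabs (fst p) <= Rabs g * radius p) by now apply Rmult_le_compat_l.
  lra.
Qed.

Definition decay (g : R) : R := exp (- (2 * PI * Rabs g)).

Lemma decay_le (g t : R) : 0 <= t <= 2 * PI -> decay g <= exp (g * t).
Proof.
  intros Ht. unfold decay.
  assert (H : - (2 * PI * Rabs g) <= g * t).
  { pose proof (Rle_abs (- g)). rewrite Rabs_Ropp in H.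
    pose proof (Rabs_pos g). nra. }
  destruct H as [H| ->]; [left; now apply exp_increasing|right; easy].
Qed.

Lemma flow_coordinates (g a t : R) (p : R * R) :
  fst (flow g a 0 p t) - a
    = exp (g * t) * ((fst p - a) * cos t + coordN g a 0 p * sin t) /\
  coordN g a 0 (flow g a 0 p t)
    = exp (g * t) * (coordN g a 0 p * cos t - (fst p - a) * sin t).
Proof.
  unfold coordN at 2, flow; simpl. split; ring.
Qed.

(** The flow multiplies X^2 + N^2 by exactly exp (2 g t), at least [decay g ^ 2] within one turn.
    The factor 1/2 comes from comparing |X| + |N| with the Euclidean norm. *)
Lemma flow_norm (g a t : R) (p : R * R) : 0 <= t <= 2 * PI ->
  (decay g * size g a p / 2) ^ 2
    <= (fst (flow g a 0 p t) - a) ^ 2 + coordN g a 0 (flow g a 0 p t) ^ 2.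
Proof.
  intros Ht. destruct (flow_coordinates g a t p) as [-> ->].
  unfold size. set (X := fst p - a). set (N := coordN g a 0 p).
  assert (Hd := decay_le g t Ht). set (k := decay g) in *.
  assert (Hk : 0 < k) by apply exp_pos.
  pose proof (sin2_cos2 t) as Hsc. unfold Rsqr in Hsc.
  replace ((exp (g * t) * (X * cos t + N * sin t)) ^ 2
    + (exp (g * t) * (N * cos t - X * sin t)) ^ 2)
    with (exp (g * t) ^ 2 * (X ^ 2 + N ^ 2) * (sin t * sin t + cos t * cos t)) by ring.
  rewrite Hsc, Rmult_1_r.
  rewrite <- (pow2_abs X), <- (pow2_abs N).
  pose proof (Rabs_pos X). pose proof (Rabs_pos N).
  apply Rle_trans with (k ^ 2 * (Rabs X ^ 2 + Rabs N ^ 2)).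
  - replace ((k * (Rabs X + Rabs N) / 2) ^ 2) with (k ^ 2 * ((Rabs X + Rabs N) / 2) ^ 2)
      by field.
    apply Rmult_le_compat_l; nra.
  - apply Rmult_le_compat_r; nra.
Qed.

Lemma large_size (g a B : R) :
  exists rho, forall p, rho < radius p -> B < size g a p.
Proof.
  exists ((1 + Rabs g) * B + (Rabs a + 2 * Rabs (g * a))). intros p Hp.
  pose proof (radius_le_size g a p). pose proof (Rabs_pos g).
  apply Rnot_le_lt. intros h. nra.
Qed.

Lemma flow_escape (g a rho : R) :
  exists rho', forall p t, 0 <= t <= 2 * PI -> rho' < radius p ->
    rho < radius (flow g a 0 p t).
Proof.
  (* A point of radius at most [Rabs rho] has size at most [B], and within one turn the size is
     multiplied by at least [decay g / 2]; hence the threshold [2 * B / decay g]. *)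
  set (B := (2 + Rabs g) * Rabs rho + (Rabs a + 3 * Rabs (g * a))).
  assert (Hk : 0 < decay g) by apply exp_pos.
  destruct (large_size g a (2 * B / decay g)) as [rho' Hrho'].
  exists rho'. intros p t Ht Hp. specialize (Hrho' p Hp).
  assert (Hn := flow_norm g a t p Ht).
  assert (Hs := size_le_radius g a (flow g a 0 p t)).
  assert (HB : 0 <= B).
  { unfold B. pose proof (Rabs_pos g). pose proof (Rabs_pos rho).
    pose proof (Rabs_pos a). pose proof (Rabs_pos (g * a)). nra. }
  assert (Hlt : B < decay g * size g a p / 2).
  { apply Rmult_lt_reg_r with (2 / decay g).
    - apply Rdiv_lt_0_compat; lra.
    - replace (decay g * size g a p / 2 * (2 / decay g)) with (size g a p)
        by (field; lra).
      replace (B * (2 / decay g)) with (2 * B / decay g) by (field; lra). easy. }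
  assert (Hsz : B < size g a (flow g a 0 p t)).
  { unfold size. rewrite <- (pow2_abs (_ - a)), <- (pow2_abs (coordN _ _ _ _)) in Hn.
    set (X := Rabs (_ - a)) in *. set (N := Rabs (coordN _ _ _ (flow _ _ _ _ _))) in *.
    assert (0 <= X) by apply Rabs_pos. assert (0 <= N) by apply Rabs_pos. nra. }
  pose proof (Rle_abs rho). pose proof (Rabs_pos g).
  apply Rnot_le_lt. intros h. unfold B in Hsz. nra.
Qed.

Lemma first_zero (f : R -> R) (d s : R) :
  (forall t, continuous f t) -> 0 < d -> (forall t, 0 < t < d -> 0 < f t) ->
  0 < s -> f s < 0 ->
  exists S, 0 < S < s /\ f S = 0 /\ forall t, 0 < t < S -> 0 < f t.
Proof.
  intros Hc Hd Hpos Hs Hfs.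
  set (E := fun t => 0 <= t <= s /\ forall v, 0 < v < t -> 0 < f v).
  destruct (completeness E) as [S [HS1 HS2]].
  - exists s. intros t [Ht _]. lra.
  - exists 0. split; [lra|]. intros v Hv. lra.
  - assert (HSs : S <= s) by (apply HS2; intros t [Ht _]; lra).
    assert (Hds : d <= s).
    { destruct (Rlt_le_dec s d) as [h|h]; [|easy]. specialize (Hpos s ltac:(lra)). lra. }
    assert (HdS : d <= S).
    { apply HS1. split; [lra|]. intros v Hv. apply Hpos. lra. }
    assert (HposS : forall v, 0 < v < S -> 0 < f v).
    { intros v Hv. destruct (Rlt_le_dec 0 (f v)) as [h|h]; [easy|exfalso].
      assert (S <= v); [|lra].
      apply HS2. intros t [Ht1 Ht2].
      destruct (Rle_lt_dec t v) as [h'|h']; [easy|].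
      specialize (Ht2 v ltac:(lra)). lra. }
    assert (Hnear : forall e : posreal, forall v, S - e < v < S + e -> ball S e v).
    { intros e v Hv. unfold ball; simpl.
      unfold AbsRing_ball, abs, minus, plus, opp; simpl. apply Rabs_def1; lra. }
    assert (Hle : ~ f S < 0).
    { intros h. destruct (near_pos (fun v => - f v) S) as [e He]; [|lra|].
      - apply (continuous_opp f). apply Hc.
      - assert (He0 := cond_pos e).
        set (v := Rmax (S - e / 2) (S / 2)).
        assert (Hv : S - e < v < S /\ 0 < v).
        { unfold v. pose proof (Rmax_l (S - e / 2) (S / 2)).
          pose proof (Rmax_r (S - e / 2) (S / 2)).
          pose proof (Rmax_lub_lt (S - e / 2) (S / 2) S ltac:(lra) ltac:(lra)). lra. }
        specialize (He v (Hnear e v ltac:(lra))).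
        specialize (HposS v ltac:(lra)). lra. }
    assert (Hge : ~ 0 < f S).
    { intros h. destruct (near_pos f S (Hc S) h) as [e He].
      assert (He0 := cond_pos e).
      assert (HSlt : S < s) by (destruct (Req_dec S s) as [->|h']; lra).
      set (t := Rmin (S + e / 2) s).
      assert (Ht : S < t /\ t <= S + e / 2 /\ t <= s).
      { unfold t. split; [apply Rmin_glb_lt; lra|]. split; [apply Rmin_l|apply Rmin_r]. }
      assert (t <= S); [|lra].
      apply HS1. split; [lra|]. intros v Hv.
      destruct (Rlt_le_dec v S) as [h'|h']; [apply HposS; lra|].
      apply He. apply Hnear. lra. }
    exists S. split; [|split; [lra|easy]].
    destruct (Req_dec S s) as [->|h]; lra.
Qed.

Lemma flow_hits_section (g a Y : R) :
  exists rho, forall p, rho < radius p ->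
    0 < fst p \/ (fst p = 0 /\ snd p < 0) ->
    exists tau y0, 0 < tau /\ Y < y0 /\ flow g a 0 p tau = (0, y0) /\
      forall t, 0 < t < tau -> 0 < fst (flow g a 0 p t).
Proof.
  (* [B] serves twice. It exceeds [Rabs a], so X < - B forces a negative abscissa at some quarter
     turn. On the section X = - a and N = g a - y, so X^2 + N^2 >= B^2 rules out [0 <= y <= Y]. *)
  set (B := Rabs a + Rabs Y + Rabs (g * a) + 1).
  assert (Hk : 0 < decay g) by apply exp_pos.
  assert (HB : 1 <= B).
  { unfold B. pose proof (Rabs_pos a). pose proof (Rabs_pos Y).
    pose proof (Rabs_pos (g * a)). lra. }
  destruct (large_size g a (2 * B / decay g)) as [rho Hrho].
  exists rho. intros p Hp Hentry. specialize (Hrho p Hp).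
  assert (Hlt : B < decay g * size g a p / 2).
  { apply Rmult_lt_reg_r with (2 / decay g).
    - apply Rdiv_lt_0_compat; lra.
    - replace (decay g * size g a p / 2 * (2 / decay g)) with (size g a p)
        by (field; lra).
      replace (B * (2 / decay g)) with (2 * B / decay g) by (field; lra). easy. }
  assert (Hsol := flow_solves g a 0 p).
  set (f := fun t => fst (flow g a 0 p t)).
  assert (Hf : forall t, continuous f t).
  { intros t. apply (solves_at_continuous _ _ _ (Hsol t)). }
  assert (Hf0 : f 0 = fst p) by (unfold f; now rewrite flow_0).
  assert (Hd : exists d, 0 < d /\ forall t, 0 < t < d -> 0 < f t).
  { destruct Hentry as [Hx|[Hx Hy]].
    - destruct (near_pos f 0 (Hf 0)) as [e He]; [now rewrite Hf0|].
      exists e. split; [apply cond_pos|]. intros t Ht. apply He.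
      unfold ball; simpl. unfold AbsRing_ball, abs, minus, plus, opp; simpl.
      apply Rabs_def1; lra.
    - destruct (Hsol 0) as [H0 _]. rewrite flow_0 in H0.
      destruct (derive_pos_right _ _ _ H0) as [d [Hd0 Hd1]].
      { unfold lin, left_field; simpl. rewrite Hx. lra. }
      exists d. split; [easy|]. intros t Ht. specialize (Hd1 t ltac:(lra)).
      cbv beta in Hd1. rewrite flow_0, Hx in Hd1. easy. }
  destruct Hd as [d [Hd0 Hd1]].
  (* At the quarter turns the rotating coordinate takes the values
     [N], [- X], [- N] and [X]. *)
  assert (Hs : exists s, 0 < s <= 2 * PI /\ f s < 0).
  { pose proof PI_RGT_0.
    set (X := fst p - a). set (N := coordN g a 0 p).
    assert (Hval : forall t c, 0 < t <= 2 * PI ->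
      X * cos t + N * sin t = c -> c <= - (size g a p / 2) -> f t < 0).
    { intros t c Ht Hc Hcs.
      destruct (flow_coordinates g a t p) as [E _]. fold X N in E. rewrite Hc in E.
      assert (Hdec := decay_le g t ltac:(lra)). pose proof (Rle_abs a).
      pose proof (Rabs_pos Y). pose proof (Rabs_pos (g * a)).
      assert (exp (g * t) * c < - B); [|unfold f; unfold B in *; lra].
      assert (B < decay g * - c) by nra. nra. }
    assert (Hsum : size g a p = Rabs X + Rabs N) by easy.
    destruct (Rle_lt_dec (Rabs N) (Rabs X)) as [h|h].
    - destruct (Rle_lt_dec 0 X) as [hX|hX].
      + exists PI. split; [lra|]. apply (Hval PI (- X)); [lra| |].
        * rewrite cos_PI, sin_PI. ring.
        * rewrite (Rabs_pos_eq X) in * by easy. lra.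
      + exists (2 * PI). split; [lra|]. apply (Hval (2 * PI) X); [lra| |].
        * rewrite cos_2PI, sin_2PI. ring.
        * rewrite (Rabs_left X) in * by easy. lra.
    - destruct (Rle_lt_dec 0 N) as [hN|hN].
      + exists (3 * (PI / 2)). split; [lra|]. apply (Hval (3 * (PI / 2)) (- N)); [lra| |].
        * rewrite cos_3PI2, sin_3PI2. ring.
        * rewrite (Rabs_pos_eq N) in * by easy. lra.
      + exists (PI / 2). split; [lra|]. apply (Hval (PI / 2) N); [lra| |].
        * rewrite cos_PI2, sin_PI2. ring.
        * rewrite (Rabs_left N) in * by easy. lra. }
  destruct Hs as [s [Hs Hfs]].
  destruct (first_zero f d s Hf Hd0 Hd1 ltac:(lra) Hfs) as [S [HS [HfS HposS]]].
  destruct (flow g a 0 p S) as [x y] eqn:HfpS.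
  assert (Hx : x = 0) by (unfold f in HfS; rewrite HfpS in HfS; exact HfS).
  subst x. exists S, y. split; [lra|]. split; [|split; [easy|exact HposS]].
  (* With [y < 0] the abscissa would be increasing through 0 at [S], against its positivity just
     before. *)
  assert (Hy0 : 0 <= y).
  { destruct (Rle_lt_dec 0 y) as [h|h]; [easy|exfalso].
    destruct (Hsol S) as [H0 _]. rewrite <- (Ropp_involutive S) in H0 at 1.
    apply is_derive_reverse in H0.
    apply (is_derive_opp (fun s => fst (flow g a 0 p (- s)))) in H0.
    destruct (derive_pos_right _ _ _ H0) as [e [He0 He1]].
    { rewrite HfpS. unfold opp, lin, left_field; simpl. lra. }
    set (v := Rmin (e / 2) (S / 2)).
    assert (Hv : 0 < v /\ v < e /\ v < S).
    { unfold v. pose proof (Rmin_l (e / 2) (S / 2)). pose proof (Rmin_r (e / 2) (S / 2)).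
      pose proof (Rmin_glb_lt (e / 2) (S / 2) 0 ltac:(lra) ltac:(lra)). lra. }
    specialize (He1 (- S + v) ltac:(lra)).
    change (- fst (flow g a 0 p (- - S)) < - fst (flow g a 0 p (- (- S + v)))) in He1.
    rewrite Ropp_involutive, HfpS in He1. cbn [fst] in He1.
    replace (- (- S + v)) with (S - v) in He1 by ring.
    specialize (HposS (S - v) ltac:(lra)). unfold f in HposS. lra. }
  assert (Hn := flow_norm g a S p ltac:(lra)). rewrite HfpS in Hn.
  unfold coordN in Hn; simpl in Hn.
  pose proof (Rle_abs Y). pose proof (Rle_abs (- (g * a))). rewrite Rabs_Ropp in *.
  pose proof (Rle_abs (g * a)). pose proof (Rabs_pos a). pose proof (pow2_abs a) as Ha2.
  pose proof (Rabs_pos Y). pose proof (Rabs_pos (g * a)).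
  apply Rnot_le_lt. intros hY.
  assert (Hyg : (y - g * a) ^ 2 <= (Rabs Y + Rabs (g * a)) ^ 2).
  { apply pow_maj_Rabs. apply Rabs_le. lra. }
  assert (HB2 : B ^ 2 < (decay g * size g a p / 2) ^ 2) by nra.
  assert (HE : (decay g * size g a p / 2) ^ 2 <= a ^ 2 + (y - g * a) ^ 2).
  { eapply Rle_trans; [|eapply Rle_trans; [exact Hn|]]; right; simpl; ring. }
  unfold B in HB2. nra.
Qed.

(** * The period annulus at infinity *)

Definition many_cycles (gL aL gR aR : R) : Prop :=
  exists Y0, forall y0, Y0 < y0 ->
    exists y1 TL TR zL zR, cycle gL aL gR aR y0 y1 TL TR zL zR.

Lemma many_cycles_reversed (gL aL gR aR : R) :
  many_cycles gL aL gR aR -> many_cycles (- gR) (- aR) (- gL) (- aL).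
Proof.
  intros [Y0 H]. exists Y0. intros y0 Hy0.
  destruct (H y0 Hy0) as [y1 [TL [TR [zL [zR Hc]]]]].
  do 5 eexists. apply cycle_reversed. exact Hc.
Qed.

(** The time [tau] may be negative: points of the left half-plane are followed backward to the upper
    part of the section. *)
Definition reaches_section (gL aL gR aR Y : R) (p : R * R) : Prop :=
  (exists z, traj gL aL gR aR z /\ z 0 = p) /\
  (forall z, traj gL aL gR aR z -> z 0 = p ->
     exists tau y0, Y < y0 /\ z tau = (0, y0)).

(** The linear orbit of [p] first meets the section high up, where a cycle passes. Its right arc
    contains [p], so a time shift of the trajectory along the cycle gives existence. *)
Lemma reaches_section_from_right (gL aL gR aR Y : R) :
  many_cycles gL aL gR aR ->
  exists rho, forall p, rho < radius p ->
    0 < fst p \/ (fst p = 0 /\ snd p < 0) -> reaches_section gL aL gR aR Y p.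
Proof.
  intros [Y0 Hcyc].
  destruct (flow_hits_section gR aR (Rmax Y Y0)) as [rho Hrho].
  exists rho. intros p Hp Hentry.
  destruct (Hrho p Hp Hentry) as [tau [y0 [Htau [Hy0 [Hhit Hpos]]]]].
  pose proof (Rmax_l Y Y0). pose proof (Rmax_r Y Y0).
  assert (HsR : on_side gL aL gR aR 1 gR aR) by now right.
  assert (Hsol := flow_solves gR aR 0 p).
  split.
  - destruct (Hcyc y0 ltac:(lra)) as [y1 [TL [TR [zL [zR Hc]]]]].
    destruct (cycle_traj_exists _ _ _ _ _ _ _ _ _ _ Hc) as [z [Hz Hz0]].
    destruct (traj_follows_cycle _ _ _ _ _ _ _ _ _ _ _ Hc Hz Hz0) as [_ HfR].
    destruct Hc as [_ _ _ HR1 HR2 HR3 HR4 HR5].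
    (* Both arcs end at [(0, y0)]: compare them backward in time. *)
    assert (Hback : forall s, 0 <= s -> zR (TR - s) = flow gR aR 0 p (tau - s)).
    { intros s Hs.
      assert (H1 := lin0_refl_solves _ _ _ HR1).
      assert (H2 := lin0_refl_solves _ _ _ Hsol).
      assert (H3 := solves_shift _ _ _ _ (- TR) H1).
      assert (H4 := solves_shift _ _ _ _ (- tau) H2).
      assert (HE : refl zR (s + - TR) = refl (flow gR aR 0 p) (s + - tau)).
      { rewrite (solves_flow _ _ _ _ s H3 Hs), (solves_flow _ _ _ _ s H4 Hs).
        f_equal. unfold refl.
        replace (- (0 + - TR)) with TR by ring. replace (- (0 + - tau)) with tau by ring.
        now rewrite HR4, Hhit. }
      unfold refl in HE.
      replace (- (s + - TR)) with (TR - s) in HE by ring.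
      replace (- (s + - tau)) with (tau - s) in HE by ring.
      destruct (zR (TR - s)) as [x1 v1], (flow gR aR 0 p (tau - s)) as [x2 v2].
      cbn [fst snd] in HE. inversion HE. f_equal. lra. }
    (* Otherwise the orbit of [p] would be at the lower point [(0, y1)] at time [tau - TR], where
       its abscissa is positive. *)
    assert (Hle : tau <= TR).
    { apply Rnot_lt_le. intros h.
      specialize (Hpos (tau - TR) ltac:(lra)). rewrite <- Hback in Hpos by lra.
      rewrite Rminus_diag, HR3 in Hpos. simpl in Hpos. lra. }
    exists (fun t => z (t + (TR - tau + TL))). split; [now apply traj_shift|].
    rewrite Rplus_0_l, HfR by lra. rewrite Hback by lra.
    rewrite Rminus_diag. apply flow_0.
  - intros z Hz Hz0. exists tau, y0. split; [lra|]. rewrite <- Hhit.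
    apply (traj_follows_flow gL aL gR aR 1 gR aR tau); try easy; try lra.
    + now rewrite flow_0.
    + apply (traj_enters gL aL gR aR 1 gR aR (snd p)); try easy. rewrite Hz0.
      destruct Hentry as [h|[h1 h2]]; [left; lra|right; split; [|lra]].
      rewrite <- h1. now destruct p.
    + intros t Ht. specialize (Hpos t Ht). lra.
Qed.

Lemma radius_reflect (p : R * R) : radius (- fst p, snd p) = radius p.
Proof. unfold radius; simpl. f_equal. ring. Qed.

Lemma far_points_reach_section (gL aL gR aR Y : R) :
  many_cycles gL aL gR aR ->
  exists rho, forall p, rho < radius p -> reaches_section gL aL gR aR Y p.
Proof.
  intros Hcyc.
  destruct (reaches_section_from_right _ _ _ _ Y Hcyc) as [r1 H1].
  destruct (reaches_section_from_right _ _ _ _ Y (many_cycles_reversed _ _ _ _ Hcyc))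
    as [r2 H2].
  destruct Hcyc as [Y0 Hcyc].
  exists (Rmax (Rmax r1 r2) (Rmax Y (Rmax Y0 0))). intros p Hp.
  pose proof (Rmax_l (Rmax r1 r2) (Rmax Y (Rmax Y0 0))).
  pose proof (Rmax_r (Rmax r1 r2) (Rmax Y (Rmax Y0 0))).
  pose proof (Rmax_l r1 r2). pose proof (Rmax_r r1 r2).
  pose proof (Rmax_l Y (Rmax Y0 0)). pose proof (Rmax_r Y (Rmax Y0 0)).
  pose proof (Rmax_l Y0 0). pose proof (Rmax_r Y0 0).
  destruct (Rtotal_order (fst p) 0) as [h|[h|h]].
  - destruct (H2 (- fst p, snd p)) as [[z [Hz Hz0]] Hall].
    + rewrite radius_reflect. lra.
    + left. simpl. lra.
    + split.
      * exists (refl z). split.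
        -- apply traj_refl in Hz. now rewrite !Ropp_involutive in Hz.
        -- unfold refl. rewrite Ropp_0, Hz0; simpl.
           rewrite Ropp_involutive. now destruct p.
      * intros w Hw Hw0. apply traj_refl in Hw.
        destruct (Hall (refl w) Hw) as [tau [y0 [Hy0 Hhit]]].
        { unfold refl. now rewrite Ropp_0, Hw0. }
        exists (- tau), y0. split; [easy|].
        unfold refl in Hhit. destruct (w (- tau)) as [x v].
        cbn [fst snd] in Hhit. inversion Hhit. f_equal. lra.
  - destruct (Rtotal_order (snd p) 0) as [hy|[hy|hy]].
    + apply H1; [lra|]. now right.
    + exfalso. pose proof (radius_le_abs p) as Hrp.
      rewrite h, hy, Rabs_R0 in Hrp. lra.
    + assert (Hpy : p = (0, snd p)) by (rewrite <- h; now destruct p).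
      assert (Hr : radius p = snd p).
      { unfold radius. rewrite h. replace (0 ^ 2 + snd p ^ 2) with (snd p ^ 2) by ring.
        apply sqrt_pow2. lra. }
      split.
      * destruct (Hcyc (snd p) ltac:(lra)) as [y1 [TL [TR [zL [zR Hc]]]]].
        destruct (cycle_traj_exists _ _ _ _ _ _ _ _ _ _ Hc) as [z [Hz Hz0]].
        exists z. split; [easy|]. now rewrite Hpy.
      * intros z Hz Hz0. exists 0, (snd p). split; [lra|]. now rewrite Hz0.
  - apply H1; [lra|]. now left.
Qed.

Lemma far_trajectories (gL aL gR aR rho : R) :
  many_cycles gL aL gR aR ->
  exists rho', forall p, rho' < radius p ->
    (exists z, traj gL aL gR aR z /\ z 0 = p) /\
    forall z, traj gL aL gR aR z -> z 0 = p ->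
      periodic z /\ forall t, rho < radius (z t).
Proof.
  intros Hcyc.
  destruct (flow_escape gL aL rho) as [r1 H1].
  destruct (flow_escape (- gR) (- aR) rho) as [r2 H2].
  assert (Hcyc' := Hcyc). destruct Hcyc' as [Y0 Hcyc'].
  destruct (far_points_reach_section _ _ _ _ (Rmax (Rmax r1 r2) Y0) Hcyc) as [r Hr].
  exists r. intros p Hp. destruct (Hr p Hp) as [Hex Hall]. split; [easy|].
  intros z Hz Hz0. destruct (Hall z Hz Hz0) as [tau [y0 [Hy0 Hhit]]].
  pose proof (Rmax_l (Rmax r1 r2) Y0). pose proof (Rmax_r (Rmax r1 r2) Y0).
  pose proof (Rmax_l r1 r2). pose proof (Rmax_r r1 r2).
  destruct (Hcyc' y0 ltac:(lra)) as [y1 [TL [TR [zL [zR Hc]]]]].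
  assert (Hs := traj_shift _ _ _ _ tau _ Hz).
  assert (Hs0 : z (0 + tau) = (0, y0)) by now rewrite Rplus_0_l.
  assert (Hper := traj_cycle_period _ _ _ _ _ _ _ _ _ _ _ Hc Hs Hs0).
  assert (Hev := traj_cycle_everywhere _ _ _ _ _ _ _ _ _ _ _ Hc Hs Hs0).
  destruct (traj_follows_cycle _ _ _ _ _ _ _ _ _ _ _ Hc Hs Hs0) as [HfL _].
  assert (Hrad : y0 <= radius (0, y0)).
  { pose proof (proj2 (abs_le_radius (0, y0))) as Ha. cbn [snd] in Ha.
    pose proof (Rle_abs y0). lra. }
  destruct Hc as [Hy00 Hy1 [HL1 [HL2 [HL3 [HL4 HL5]]]] HR1 HR2 HR3 HR4 HR5].
  cbv beta in Hper, Hev, HfL.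
  split; [split|].
  - exists (TL + TR). split; [lra|]. intros t. specialize (Hper (t - tau)).
    replace (t - tau + (TL + TR) + tau) with (t + (TL + TR)) in Hper by ring.
    now replace (t - tau + tau) with t in Hper by ring.
  (* The orbit contains [(0, y0)] and [(0, y1)] with [y1 < 0 < y0]; at least one of them differs
     from [z 0]. *)
  - destruct (Req_dec (snd (z 0)) y0) as [h|h].
    + exists (TL + tau). rewrite HfL, HL4 by lra. intros E. rewrite <- E in h.
      simpl in h. lra.
    + exists tau. rewrite Hhit. intros E. apply h. now rewrite <- E.
  - intros t. specialize (Hev (t - tau)).
    replace (t - tau + tau) with t in Hev by ring.
    destruct Hev as [[s [Hs1 ->]]|[s [Hs1 ->]]].
    + rewrite (solves_flow _ _ _ zL s HL1) by lra. rewrite HL3. apply H1; lra.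
    (* The point known to be far is [(0, y0)], where the right arc ends; the arc is therefore
       followed from there, backward, after reflection. *)
    + assert (Hrev := reversed_solves gR aR TR zR HR1).
      rewrite <- radius_reflect.
      replace (- fst (zR s), snd (zR s)) with (reversed zR TR (TR - s)).
      2:{ rewrite reversed_eq. now replace (TR - (TR - s)) with s by ring. }
      rewrite (solves_flow _ _ _ _ (TR - s) Hrev) by lra.
      rewrite reversed_eq, Rminus_0_r, HR4. cbn [fst snd]. rewrite Ropp_0.
      apply H2; lra.
Qed.

(** A periodic trajectory takes its initial radius again at arbitrarily large times, so its radius
    cannot tend to infinity; and trajectories staying beyond any given radius exist, so the orbit at
    infinity is not isolated. *)
Lemma annulus_properties (gL aL gR aR : R) :
  let fL := lin0 gL aL in
  let fR := lin0 gR aR in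
  many_cycles gL aL gR aR ->
  period_annulus_at_infinity fL fR /\
  orbitally_stable_at_infinity fL fR /\
  ~ isolated_at_infinity fL fR /\
  ~ orbitally_asymptotically_stable_at_infinity fL fR.
Proof.
  intros fL fR Hcyc.
  assert (Hradius : forall r, r < radius (0, Rabs r + 1)).
  { intros r. pose proof (proj2 (abs_le_radius (0, Rabs r + 1))) as Ha. cbn [snd] in Ha.
    pose proof (Rle_abs r). pose proof (Rle_abs (Rabs r + 1)). lra. }
  split; [|split; [|split]].
  - destruct (far_trajectories _ _ _ _ 0 Hcyc) as [r Hr].
    exists r. intros p Hp. destruct (Hr p Hp) as [[z [Hz Hz0]] Hall]. split.
    + exists z. split; [now apply trajectory_traj|easy].
    + intros w Hw Hw0. apply trajectory_traj in Hw. now apply Hall.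
  - intros rho. destruct (far_trajectories _ _ _ _ rho Hcyc) as [r Hr].
    exists r. intros z Hz Hz0 t _. apply trajectory_traj in Hz.
    now apply (Hr (z 0) Hz0).
  - intros [rho Hiso]. apply Hiso.
    destruct (far_trajectories _ _ _ _ rho Hcyc) as [r Hr].
    destruct (Hr _ (Hradius r)) as [[z [Hz Hz0]] Hall].
    exists z. split; [now apply trajectory_traj|]. now apply Hall.
  - intros [_ [rho Hlim]].
    destruct (far_trajectories _ _ _ _ 0 Hcyc) as [r Hr].
    assert (Hp := Hradius (Rmax rho r)).
    pose proof (Rmax_l rho r). pose proof (Rmax_r rho r).
    set (p := (0, Rabs (Rmax rho r) + 1)) in *.
    destruct (Hr p ltac:(lra)) as [[z [Hz Hz0]] Hall].
    destruct (Hall z Hz Hz0) as [[[T [HT Hper]] _] _].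
    assert (HL : is_lim (fun t => radius (z t)) p_infty p_infty).
    { apply Hlim; [now apply trajectory_traj|]. rewrite Hz0. lra. }
    apply is_lim_spec in HL. destruct (HL (radius (z 0))) as [M HM].
    destruct (archimedean_multiple T (M + 1) HT) as [n Hn].
    specialize (HM (INR n * T) ltac:(lra)).
    assert (HnT : z (INR n * T) = z 0).
    { clear - Hper. induction n as [|n IH].
      - simpl. f_equal. ring.
      - rewrite S_INR, <- IH, <- (Hper (INR n * T)). f_equal. ring. }
    rewrite HnT in HM. lra.
Qed.

(** For [g = 0] the flow is a rotation about [(a, 0)], so y^2 + a^2 takes the same value at both
    ends of the arc. *)
Lemma left_arc_symmetric (a y0 y1 T : R) (z : R -> R * R) :
  left_arc (lin0 0 a) y0 y1 T z -> 0 < y0 -> y1 < 0 -> y1 = - y0.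
Proof.
  intros [Hz [HT [Hz0 [HzT _]]]] H0 H1.
  assert (HE := solves_flow 0 a 0 z T Hz ltac:(lra)).
  rewrite HzT, Hz0 in HE. unfold flow, coordN in HE; simpl in HE.
  rewrite Rmult_0_l, exp_0 in HE. inversion HE as [[E1 E2]].
  pose proof (sin2_cos2 T) as Hsc. unfold Rsqr in Hsc.
  assert (Ey : y1 = y0 * cos T - a * sin T) by (rewrite E2; ring).
  assert (Ea : a = a * cos T + y0 * sin T) by lra.
  assert (Hsq : y1 * y1 + a * a = (y0 * y0 + a * a)).
  { transitivity ((y0 * y0 + a * a) * (sin T * sin T + cos T * cos T));
      [|rewrite Hsc; ring].
    rewrite Ey. rewrite Ea at 3 4. ring. }
  nra.
Qed.

(** In the first case the reflected right system is the left system itself, and both half-returns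
    agree by uniqueness. In the second case both half-returns are y -> - y, whatever the
    equilibria. *)
Lemma center_cycles (gL gR aL aR : R) :
  (gL = - gR /\ aL = - aR) \/ (gL = 0 /\ gR = 0) ->
  many_cycles gL aL gR aR /\ center_at_infinity (lin gL aL 0) (rin gR aR 0).
Proof.
  intros Hcase.
  destruct (left_half_return gL aL 0) as [mL [dL [_ [_ [HdL HL]]]]].
  destruct (left_half_return (- gR) (- aR) (- 0)) as [mR [dR [_ [_ [HdR HR]]]]].
  set (eps := Rmin dL dR).
  assert (Heps : 0 < eps) by now apply Rmin_glb_lt.
  assert (Hle : eps <= dL /\ eps <= dR) by (split; [apply Rmin_l|apply Rmin_r]).
  assert (Hall : forall u, 0 < u < eps -> exists y1 TL TR zL zR,
    y1 < 0 /\ left_arc (lin0 gL aL) (/ u) y1 TL zL /\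
    left_arc (lin0 (- gR) (- aR)) (/ u) y1 TR zR).
  { intros u Hu.
    destruct (HL u ltac:(lra)) as [y1 [T1 [z1 [H1 [H1b [Harc1 _]]]]]].
    destruct (HR u ltac:(lra)) as [y2 [T2 [z2 [H2 [H2b [Harc2 _]]]]]].
    rewrite Ropp_0 in Harc2, H2b.
    assert (Hy : y2 = y1).
    { destruct Hcase as [[Hg Ha]|[HgL HgR]].
      - rewrite <- Hg, <- Ha in Harc2.
        apply (left_return_unique gL aL 0 (/ u) y1 T1 y2 z1 Harc1 H1b).
        now apply left_arc_return with (1 := Harc2).
      - assert (0 < / u) by (apply Rinv_0_lt_compat; lra).
        rewrite HgL in Harc1. rewrite HgR, Ropp_0 in Harc2.
        rewrite (left_arc_symmetric _ _ _ _ _ Harc1),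
          (left_arc_symmetric _ _ _ _ _ Harc2); easy. }
    subst y2. now exists y1, T1, T2, z1, z2. }
  split.
  - exists (/ eps). intros y0 Hy0.
    assert (0 < / eps) by now apply Rinv_0_lt_compat.
    destruct (Hall (/ y0)) as [y1 [TL [TR [zL [zR [H1 [HL1 HR1]]]]]]].
    { split; [apply Rinv_0_lt_compat; lra|].
      rewrite <- (Rinv_inv eps). apply Rinv_lt_contravar; [nra|easy]. }
    rewrite Rinv_inv in HL1, HR1.
    exists y1, TL, TR, zL, (reversed zR TR).
    destruct HR1 as [K1 [K2 [K3 [K4 K5]]]].
    split; try easy; try lra.
    + apply (reversed_solves _ _ TR) in K1. now rewrite !Ropp_involutive in K1.
    + rewrite reversed_eq, Rminus_0_r, K4. cbn [fst snd]. now rewrite Ropp_0.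
    + rewrite reversed_eq, Rminus_diag, K3. cbn [fst snd]. now rewrite Ropp_0.
    + intros t Ht. rewrite reversed_eq. cbn [fst snd].
      specialize (K5 (TR - t) ltac:(lra)). lra.
  - exists eps. split; [easy|]. intros u Hu.
    destruct (Hall u Hu) as [y1 [TL [TR [zL [zR [H1 [HL1 HR1]]]]]]].
    unfold Defs.Delta, Lmap, Rmap.
    rewrite (proj1 (ord1_eq gL aL 0 (/ u) y1 TL zL HL1 H1 ltac:(lra))).
    unfold lin0 in HR1. rewrite <- Ropp_0 in HR1.
    rewrite (proj1 (ord2_eq gR aR 0 (/ u) y1 TR zR HR1 H1 ltac:(lra))).
    ring.
Qed.

Theorem theorem7 (gL gR aL aR b : R) :
  let fL := left_field gL aL b in
  let fR := right_field gR aR b in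
  let xL := aL / (1 + gL ^ 2) in
  let xR := aR / (1 + gR ^ 2) in
  let yL := 2 * gL * xL - b in
  let yR := 2 * gR * xR + b in
  let hypA := gL = - gR /\ yL - yR <> 0 in
  let hypB := gL = - gR /\ gL <> 0 /\ yL = yR /\ xL ^ 2 - xR ^ 2 <> 0 in
  let hypC := gL = - gR /\ gL <> 0 /\ (yL = 0 /\ yR = 0) /\ (xL = xR /\ xL <> 0) in
  let three := gL = - gR /\ yL = yR /\ xL = - xR in
  returns_well_defined fL fR /\
  (gL + gR > 0 -> hyperbolic_at_infinity fL fR /\ stable_at_infinity fL fR) /\
  (gL + gR < 0 -> hyperbolic_at_infinity fL fR /\ unstable_at_infinity fL fR) /\
  (gL + gR = 0 ->
     ~ hyperbolic_at_infinity fL fR /\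
     ((exists k : nat, weak_focus_at_infinity fL fR k) \/
      center_at_infinity fL fR)) /\
  (* (a) *)
  (gL = - gR ->
     (yL - yR <> 0 <-> b - gL * (xL + xR) <> 0) /\
     (yR - yL > 0 <-> b > gL * (xL + xR))) /\
  (hypA ->
     weak_focus_at_infinity fL fR 1 /\
     (yR - yL > 0 -> stable_at_infinity fL fR) /\
     (~ (yR - yL > 0) -> unstable_at_infinity fL fR)) /\
  (* (b) *)
  (hypB ->
     weak_focus_at_infinity fL fR 2 /\
     (gL * (xL ^ 2 - xR ^ 2) > 0 -> stable_at_infinity fL fR) /\
     (gL * (xL ^ 2 - xR ^ 2) < 0 -> unstable_at_infinity fL fR)) /\
  (* (c) *)
  (hypC ->
     weak_focus_at_infinity fL fR 3 /\
     (gL * xL < 0 -> stable_at_infinity fL fR) /\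
     (gL * xL > 0 -> unstable_at_infinity fL fR)) /\
  (* (d): what "otherwise" means, then its conclusions *)
  (gL = - gR ->
     ((~ hypA /\ ~ hypB /\ ~ hypC) <-> (three \/ (gL = 0 /\ gR = 0 /\ b = 0)))) /\
  (gL = - gR -> ~ hypA -> ~ hypB -> ~ hypC ->
     b = 0 /\
     center_at_infinity fL fR /\
     period_annulus_at_infinity fL fR /\
     ((gL = 0 /\ gR = 0 /\ b = 0) \/
      (gL = - gR /\ gL <> 0 /\ (xL = 0 /\ xR = 0) /\ b = 0) \/
      (gL = - gR /\ gL <> 0 /\ (xL = - xR /\ xL <> 0) /\ b = 0)) /\
     orbitally_stable_at_infinity fL fR /\
     ~ isolated_at_infinity fL fR /\
     ~ orbitally_asymptotically_stable_at_infinity fL fR).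

Proof.
  intros fL fR xL xR yL yR hypA hypB hypC three.
  assert (HL : fL = lin gL xL b).
  { unfold fL, lin, xL. f_equal. field. nra. }
  assert (HR : fR = rin gR xR b).
  { unfold fR, rin, xR. f_equal. field. nra. }
  clearbody fL fR xL xR. subst fL fR.
  destruct (hyperbolic_case gL gR xL xR b) as [Hh1 [Hh2 Hh3]].
  assert (Hw := weak_focus_cases gL gR xL xR b). cbv zeta in Hw.
  fold yL yR in Hw.
  assert (Hother : gL = - gR -> ~ hypA -> ~ hypB -> ~ hypC ->
    three \/ (gL = 0 /\ gR = 0 /\ b = 0)).
  { intros Hg HA HB HC.
    assert (Hy : yL = yR).
    { destruct (Req_dec yL yR) as [h|h]; [easy|]. exfalso. apply HA. split; lra. }
    (* For [gL = 0] the equality [yL = yR] reduces to [b = 0] and leaves [xL] and [xR] free, which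
       is why [three] alone does not cover the remaining case. *)
    destruct (Req_dec gL 0) as [Hg0|Hg0].
    { right. assert (gR = 0) by lra. split; [easy|]. split; [easy|].
      unfold yL, yR in Hy. rewrite Hg0, H in Hy. lra. }
    left. split; [easy|]. split; [easy|].
    assert (Hsq : xL ^ 2 - xR ^ 2 = 0).
    { destruct (Req_dec (xL ^ 2 - xR ^ 2) 0) as [h|h]; [easy|].
      exfalso. now apply HB. }
    assert (Hprod : (xL - xR) * (xL + xR) = 0) by (rewrite <- Hsq; ring).
    apply Rmult_integral in Hprod. destruct Hprod as [h|h]; [|lra].
    assert (HxLR : xL = xR) by lra.
    destruct (Req_dec xL 0) as [h0|h0]; [lra|].
    exfalso. apply HC. split; [easy|]. split; [easy|]. split; [|easy].
    (* Equal abscissas make the ordinates opposite; being also equal, both vanish, and case (c)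
       would apply. *)
    assert (yR = - yL); [|lra].
    unfold yL, yR. rewrite <- HxLR, Hg. ring. }
  assert (Hcenter : three \/ (gL = 0 /\ gR = 0 /\ b = 0) ->
    b = 0 /\ ((gL = - gR /\ xL = - xR) \/ (gL = 0 /\ gR = 0))).
  { intros [[Hg [Hy Hx]]|[Hg1 [Hg2 Hb]]]; [|auto].
    split; [|now left]. unfold yL, yR in Hy. rewrite Hg, Hx in Hy. lra. }
  assert (HA : hypA ->
     weak_focus_at_infinity (lin gL xL b) (rin gR xR b) 1 /\
     (yR - yL > 0 -> stable_at_infinity (lin gL xL b) (rin gR xR b)) /\
     (~ (yR - yL > 0) -> unstable_at_infinity (lin gL xL b) (rin gR xR b))).
  { intros [Hg Hy]. destruct (Hw Hg) as [H _]. destruct (H Hy) as [H1 [H2 H3]].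
    split; [easy|]. split; [easy|]. intros Hn. apply H3. lra. }
  assert (HB : hypB ->
     weak_focus_at_infinity (lin gL xL b) (rin gR xR b) 2 /\
     (gL * (xL ^ 2 - xR ^ 2) > 0 -> stable_at_infinity (lin gL xL b) (rin gR xR b)) /\
     (gL * (xL ^ 2 - xR ^ 2) < 0 -> unstable_at_infinity (lin gL xL b) (rin gR xR b))).
  { intros [Hg [Hg0 [Hy Hx]]]. now apply (Hw Hg). }
  assert (HC : hypC ->
     weak_focus_at_infinity (lin gL xL b) (rin gR xR b) 3 /\
     (gL * xL < 0 -> stable_at_infinity (lin gL xL b) (rin gR xR b)) /\
     (gL * xL > 0 -> unstable_at_infinity (lin gL xL b) (rin gR xR b))).
  { intros [Hg [Hg0 [[Hy1 Hy2] [Hx1 Hx2]]]]. now apply (Hw Hg). }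
  split; [exact (proj1 (displacement_expansion gL gR xL xR b))|].
  split; [easy|]. split; [easy|]. split.
  { intros Hg. split; [now apply Hh3|].
    destruct (classic hypA) as [h|hA]; [left; exists 1%nat; now apply HA|].
    destruct (classic hypB) as [h|hB]; [left; exists 2%nat; now apply HB|].
    destruct (classic hypC) as [h|hC]; [left; exists 3%nat; now apply HC|].
    right. destruct (Hcenter (Hother ltac:(lra) hA hB hC)) as [Hb Hcase].
    rewrite Hb. now apply center_cycles. }
  split.
  { intros Hg. unfold yL, yR. rewrite Hg. split; split; intros h; lra. }
  split; [exact HA|]. split; [exact HB|]. split; [exact HC|]. split.
  { intros Hg. split; [intros [hA [hB hC]]; now apply Hother|].
    intros Hcase. destruct (Hcenter Hcase) as [Hb Hcase2].
    assert (Hy : yL = yR).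
    { destruct Hcase as [[_ [h _]]|[h1 [h2 _]]]; [easy|].
      unfold yL, yR. rewrite h1, h2, Hb. ring. }
    split; [intros [_ h]; lra|].
    assert (Hx : gL <> 0 -> xL = - xR).
    { intros Hg0. now destruct Hcase as [[_ [_ h]]|[h _]]. }
    split.
    - intros [_ [Hg0 [_ h]]]. apply h. rewrite (Hx Hg0). ring.
    - intros [_ [Hg0 [_ [h1 h2]]]]. specialize (Hx Hg0). lra. }
  intros Hg hA hB hC.
  assert (Hcase := Hother Hg hA hB hC).
  destruct (Hcenter Hcase) as [Hb Hcase2].
  split; [easy|].
  destruct (center_cycles gL gR xL xR Hcase2) as [Hcyc Hcen].
  assert (Hrin : rin gR xR 0 = lin0 gR xR).
  { apply functional_extensionality. intros p.
    unfold rin, lin0, lin, left_field, right_field. f_equal. ring. }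
  destruct (annulus_properties gL xL gR xR Hcyc) as [P1 [P2 [P3 P4]]].
  rewrite <- Hrin in P1, P2, P3, P4.
  rewrite Hb. split; [exact Hcen|]. split; [exact P1|].
  split; [|split; [exact P2|split; [exact P3|exact P4]]].
  destruct (Req_dec gL 0) as [Hg0|Hg0]; [left; repeat split; lra|].
  right.
  assert (Hx : xL = - xR) by (destruct Hcase2 as [[_ h]|[h _]]; easy).
  destruct (Req_dec xL 0) as [Hx0|Hx0]; [left|right]; repeat split; try easy; lra.
Qed.
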